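(* Let $q^1,\dots,q^m$ be i.i.d. samples from a distribution $\mathbb P$ on $\Delta_n$. Let $\hat p_{\varepsilon'}\in\Delta_n$ satisfy $$\frac1m\sum_{i=1}^mW_\gamma(\hat p_{\varepsilon'},q^i)-\frac1m\sum_{i=1}^mW_\gamma(\hat p_\gamma^*,q^i)\le\varepsilon',$$ where $\hat p_\gamma^*=\arg\min_{p\in\Delta_n}\frac1m\sum_{i=1}^mW_\gamma(p,q^i)$, $\varepsilon'=O\left(\frac{\varepsilon^2\gamma}{n\|C\|_\infty^2}\right)$, $m=O\left(\frac{n\|C\|_\infty^2}{\beta\gamma\varepsilon}\right)$, and $\gamma=\varepsilon/(2\mathcal R^2)$ with $\mathcal R^2=2\log n$. Then with probability at least $1-\beta$, $$W(\hat p_{\varepsilon'})-W(p^* )\le\varepsilon,$$ where $W(p)=\mathbb{E}_{q\sim\mathbb P}W(p,q)$ and $p^*\in\arg\min_{p\in\Delta_n}W(p)$. The total complexity of the accelerated iterative Bregman projections (accelerated IBP) algorithm computing $\hat p_{\varepsilon'}$ is $\widetilde O\left(\frac{n^4\|C\|_\infty^4}{\beta\varepsilon^4}\right)$.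
   Context: $\Delta_n$ is the probability simplex; $C\in\mathbb{R}^{n\times n}_+$ is a symmetric cost matrix with $\|C\|_\infty$ its largest entry; $U(p,q)=\{\pi\in\mathbb{R}_+^{n\times n}:\pi\mathbf 1=p,\pi^\top\mathbf 1=q\}$; $W(p,q)=\min_{\pi\in U(p,q)}\langle C,\pi\rangle$; $W_\gamma(p,q)=\min_{\pi\in U(p,q)}\{\langle C,\pi\rangle+\gamma\langle\pi,\log\pi\rangle\}$, which is $\gamma$-strongly convex in $p$ in the $\ell_2$-norm. Standing convention: measures are bounded away from the boundary of $\Delta_n$ (after adding a small noise and normalizing), so that $W_\gamma(\cdot,q)$ and $W(\cdot,q)$ are Lipschitz in the $\ell_2$-norm with constant $O(\sqrt n\|C\|_\infty)$. The accelerated IBP is an accelerated alternating minimization method for the dual of $\min_{p\in\Delta_n}\frac1m\sum_iW_\gamma(p,q^i)$; it finds an $\varepsilon'$-minimizer in $\widetilde O\big(mn^2\sqrt n\|C\|_\infty/\sqrt{\gamma\varepsilon'}\big)$ arithmetic operations. $\widetilde O$ hides logarithmic factors; setting a parameter to $O(E)$ means with a suitable constant. *)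

(* Defs.v *)
From HB Require Import structures.
From mathcomp Require Export all_boot all_order all_algebra.
From mathcomp Require Export all_classical all_reals all_analysis.
Export Order.TTheory GRing.Theory Num.Theory.
Export numFieldNormedType.Exports.

Set Implicit Arguments.
Unset Strict Implicit.
Unset Printing Implicit Defensive.

Local Open Scope classical_set_scope.
Local Open Scope ring_scope.

Section OptimalTransport.
Context {R : realType} {n : nat}.
Implicit Types (C pi : 'M[R]_n) (p q v : 'rV[R]_n).

Definition simplex : set 'rV[R]_n :=
  [set p | (forall j, 0 <= p 0 j) /\ \sum_j p 0 j = 1].

Definition inner_simplex (rho : R) : set 'rV[R]_n :=
  [set p | simplex p /\ forall j, rho <= p 0 j].

Definition l2norm v : R := Num.sqrt (\sum_j v 0 j ^+ 2).

(* For a cost matrix the library norm `|C|, the largest absolute value of an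
   entry, is the largest entry. *)
Definition cost_matrix C : Prop :=
  C^T = C /\ forall i j, 0 <= C i j.

Definition couplings p q : set 'M[R]_n :=
  [set pi | [/\ forall i j, 0 <= pi i j,
                forall i, \sum_j pi i j = p 0 i
              & forall j, \sum_i pi i j = q 0 j]].

Definition mxdot (A B : 'M[R]_n) : R := \sum_i \sum_j A i j * B i j.

(* For p, q in the simplex, the polytope of couplings is nonempty and compact,
   so the infima below are minima.  A zero entry of pi contributes 0 to
   <pi, log pi>. *)
Definition W C p q : R :=
  inf [set mxdot C pi | pi in couplings p q].

Definition Wreg (gamma : R) C p q : R :=
  inf [set mxdot C pi + gamma * mxdot pi (map_mx (@ln R) pi)
      | pi in couplings p q].

Definition empirical_Wreg (gamma : R) C m (q : 'I_m -> 'rV[R]_n) p : R :=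
  m%:R^-1 * \sum_i Wreg gamma C p (q i).

Definition lipschitz_l2 (A : set 'rV[R]_n) (M : R) (f : 'rV[R]_n -> R) : Prop :=
  forall p p', A p -> A p' -> `|f p - f p'| <= M * l2norm (p - p').

(* L is the constant hidden in the Lipschitz constant O(sqrt n * `|C|).  The
   domain matters: the slope of Wreg gamma C ^~ q is unbounded near the boundary
   of the simplex. *)
Definition lipschitz_convention (L rho gamma : R) C : Prop :=
  forall q, inner_simplex rho q ->
    lipschitz_l2 (inner_simplex rho) (L * Num.sqrt n%:R * `|C|) (W C ^~ q) /\
    lipschitz_l2 (inner_simplex rho) (L * Num.sqrt n%:R * `|C|)
      (Wreg gamma C ^~ q).

Definition is_argmin (A : set 'rV[R]_n) (f : 'rV[R]_n -> R) p : Prop :=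
  A p /\ forall p', A p' -> f p <= f p'.

Definition is_approx_argmin (e : R) (A : set 'rV[R]_n) (f : 'rV[R]_n -> R) p :
  Prop := A p /\ forall p', A p' -> f p - f p' <= e.

End OptimalTransport.

(* 'rV[R]_n with its Borel sigma-algebra. *)
Notation borel_rV R n := (g_sigma_algebraType (@open 'rV[R]_n)).

Section Sampling.
Context {R : realType} {n : nat}.

Definition population_W (C : 'M[R]_n) (P : probability (borel_rV R n) R)
  (p : 'rV[R]_n) : R := \int[P]_q W C p q.

(* The family is finite, so the product rule over the full index set yields the
   rule for subfamilies: take A i = setT for the other indices. *)
Definition iid_sample d (Omega : measurableType d) (Pr : probability Omega R)
    m (P : probability (borel_rV R n) R)
    (q : 'I_m -> {RV Pr >-> borel_rV R n}) : Prop :=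
  (forall i (A : set (borel_rV R n)), measurable A ->
     distribution Pr (q i) A = P A) /\
  (forall A : 'I_m -> set (borel_rV R n), (forall i, measurable (A i)) ->
     Pr (\bigcap_i (q i @^-1` A i)) = (\prod_i Pr (q i @^-1` A i))%E).

End Sampling.

(* Pr E >= b; stated through a measurable subset because E may depend on an
   estimator that is not assumed to be measurable. *)
Definition with_probability_ge {R : realType} d (Omega : measurableType d)
    (Pr : probability Omega R) (b : R) (E : set Omega) : Prop :=
  exists A, [/\ measurable A, A `<=` E & (b%:E <= Pr A)%E].

Section Constants.
Context {R : realType}.

Definition Rsqr_entropy (n : nat) : R := 2 * ln n%:R.

Definition reg_param (n : nat) (eps : R) : R := eps / (2 * Rsqr_entropy n).

(* The constant c hidden in O( ) is an argument. *)
Definition inner_accuracy n (c : R) (C : 'M[R]_n) (eps gamma : R) : R :=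
  c * (eps ^+ 2 * gamma / (n%:R * `|C| ^+ 2)).

Definition sample_size n (c : R) (C : 'M[R]_n) (beta gamma eps : R) : nat :=
  `|Num.ceil (c * (n%:R * `|C| ^+ 2 / (beta * gamma * eps)))|%N.

(* A soft-O bound hides a constant times a power of this quantity, where s lists
   the parameters whose logarithms are hidden. *)
Definition log_factor (s : seq R) : R := 1 + \sum_(x <- s) `|ln x|.

End Constants.

(* Random-access machine over the reals with unit-cost operations: +, -, *, /,
   exp, ln and comparison.  A state is a program counter with a register file;
   a program stops at Halt, or when the counter leaves the program. *)
Inductive binop := OpAdd | OpSub | OpMul | OpDiv.

Inductive unop := OpExp | OpLn.

Inductive instr :=
  | Const of nat & int
  | Copy of nat & nat
  | Bin of binop & nat & nat & nat
  | Un of unop & nat & nat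
  | JumpLe of nat & nat & nat
  | Halt.

Section Machine.
Context {R : realType}.

Definition state : Type := nat * (nat -> R).

Definition set_reg (r : nat -> R) (d : nat) (x : R) : nat -> R :=
  fun k => if k == d then x else r k.

Definition eval_bin (o : binop) (x y : R) : R :=
  match o with
  | OpAdd => x + y | OpSub => x - y | OpMul => x * y | OpDiv => x / y
  end.

Definition eval_un (o : unop) (x : R) : R :=
  match o with OpExp => expR x | OpLn => ln x end.

Definition step (prog : seq instr) (s : state) : option state :=
  let: (pc, r) := s in
  match nth Halt prog pc with
  | Const d c => Some (pc.+1, set_reg r d c%:~R)
  | Copy d a => Some (pc.+1, set_reg r d (r a))
  | Bin o d a b => Some (pc.+1, set_reg r d (eval_bin o (r a) (r b)))
  | Un o d a => Some (pc.+1, set_reg r d (eval_un o (r a)))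
  | JumpLe a b l => Some (if r a <= r b then l else pc.+1, r)
  | Halt => None
  end.

Fixpoint exec (prog : seq instr) (N : nat) (s : state) : option state :=
  if N is N'.+1 then obind (exec prog N') (step prog s) else Some s.

(* Registers 0, 1, ... initially hold the entries of C (row by row), those of
   q 0, ..., q (m - 1), then gamma and eps'; the other registers hold 0. *)
Definition input n m (C : 'M[R]_n) (q : 'I_m -> 'rV[R]_n) (gamma eps' : R) :
    seq R :=
  [seq C i j | i <- enum 'I_n, j <- enum 'I_n] ++
  [seq q i 0 j | i <- enum 'I_m, j <- enum 'I_n] ++ [:: gamma; eps'].

(* The program stops after exactly N operations, with the coordinates of p in
   registers 0, ..., n - 1. *)
Definition computes_in (prog : seq instr) n m (C : 'M[R]_n)
    (q : 'I_m -> 'rV[R]_n) (gamma eps' : R) (N : nat) (p : 'rV[R]_n) : Prop :=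
  exists s : state,
    [/\ exec prog N (0%N, nth 0 (input C q gamma eps')) = Some s,
        step prog s = None & p = \row_(j < n) s.2 j].

(* The running time of accelerated IBP: soft-O of
   m n^2 sqrt n `|C| / sqrt (gamma eps').  Such a bound concerns small
   parameters; gamma, eps' <= `|C| makes it at least one iteration. *)
Definition accelerated_IBP_guarantee (algo : nat -> nat -> seq instr) : Prop :=
  exists (K : R) (k : nat), forall (n m : nat) (C : 'M[R]_n)
      (q : 'I_m -> 'rV[R]_n) (gamma eps' : R),
    (1 < n)%N -> (0 < m)%N -> cost_matrix C -> 0 < `|C| ->
    (forall i, simplex (q i)) ->
    0 < gamma <= `|C| -> 0 < eps' <= `|C| ->
    exists (N : nat) (p : 'rV[R]_n),
      [/\ computes_in (algo n m) C q gamma eps' N p,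
          is_approx_argmin eps' simplex (empirical_Wreg gamma C q) p
        & N%:R <= K * (m%:R * n%:R ^+ 2 * Num.sqrt n%:R * `|C|
                        / Num.sqrt (gamma * eps'))
                    * log_factor [:: n%:R; m%:R; `|C|; gamma; eps'] ^+ k].

End Machine.

(* Main.v *)
(* Regularized empirical risk minimization is stable: by Pinsker-type strong
   convexity of the entropy, the loss Wreg gamma C ^~ q is strongly convex in the
   l2-norm with a modulus of order gamma; hence changing one of the m samples moves the
   empirical minimizer by O(M / (gamma m)), M being the Lipschitz constant.
   Exchanging a sample with an independent copy, the expected excess population
   risk of the minimizer is O(M^2 / (gamma m)), and Markov's inequality turns
   this into a bound with probability 1 - beta.  Strong convexity also bounds the
   distance from an eps'-minimizer to the exact one, and
   W - 2 gamma ln n <= Wreg <= W removes the regularization.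

   To avoid measurable selections, the samples are rounded to the cells of a fine
   grid, so that the expectations are finite sums over a product of finite
   types.  The Lipschitz hypothesis holds in q as well as in p because C is
   symmetric, so the rounding error is as small as desired. *)
Require Import Defs.
From mathcomp Require Import measurable_realfun ring lra.

Set Implicit Arguments.
Unset Strict Implicit.
Unset Printing Implicit Defensive.

Local Open Scope classical_set_scope.
Local Open Scope ring_scope.

(** * Comparison of the l1- and l2-norms *)

Lemma sqr_sum_norm_le (R : realType) (I : finType) (a : I -> R) :
  (\sum_i `|a i|) ^+ 2 <= #|I|%:R * \sum_i a i ^+ 2.
Proof.
have [I0|I0] := posnP #|I|.
  rewrite I0 mul0r big1 ?expr0n // => i _.
  by have := max_card (pred1 i); rewrite I0 card1.
set N : R := #|I|%:R; set S := \sum_i `|a i|.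
have N0 : 0 < N by rewrite ltr0n.
(* Cauchy-Schwarz comes from summing [(|a i| - c)^2 >= 0]; the mean is the best [c]. *)
set c := S / N.
have : \sum_i (2 * c * `|a i| - c ^+ 2) <= \sum_i a i ^+ 2.
  apply: ler_sum => i _; have := sqr_ge0 (`|a i| - c).
  by rewrite sqrrB real_normK ?num_real //; lra.
rewrite sumrB -mulr_sumr sumr_const -mulr_natr -/S -/N => h.
apply: le_trans (ler_wpM2l (ltW N0) h); rewrite le_eqVlt; apply/orP; left.
by apply/eqP; rewrite /c; field; rewrite gt_eqF.
Qed.

Section L2norm.
Context {R : realType} {n : nat}.
Implicit Types v : 'rV[R]_n.

Lemma l2norm_ge0 v : 0 <= l2norm v.
Proof. exact: sqrtr_ge0. Qed.

Lemma sqr_l2norm v : l2norm v ^+ 2 = \sum_j v 0 j ^+ 2.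
Proof. by rewrite sqr_sqrtr // sumr_ge0 // => j _; exact: sqr_ge0. Qed.

Lemma l2normB v v' : l2norm (v - v') = l2norm (v' - v).
Proof.
by congr Num.sqrt; apply: eq_bigr => j _; rewrite !mxE -sqrrN opprB.
Qed.

Lemma sum_norm_le_l2norm v : \sum_j `|v 0 j| <= Num.sqrt n%:R * l2norm v.
Proof.
rewrite -(@ler_pXn2r _ 2) ?nnegrE ?mulr_ge0 ?sqrtr_ge0 ?sumr_ge0 //.
by rewrite exprMn sqr_sqrtr // sqr_l2norm -[X in X%:R]card_ord sqr_sum_norm_le.
Qed.

Lemma l2norm_le_sum_norm v : l2norm v <= \sum_j `|v 0 j|.
Proof.
have S0 : 0 <= \sum_j `|v 0 j| by exact: sumr_ge0.
rewrite -(@ler_pXn2r _ 2) ?nnegrE ?l2norm_ge0 // sqr_l2norm expr2 mulr_suml.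
apply: ler_sum => j _; rewrite -real_normK ?num_real // expr2 ler_wpM2l //.
by rewrite (bigD1 j) //= lerDl sumr_ge0.
Qed.

End L2norm.

(** * Pointwise inequalities for [x ln x] *)

Section Entropy.
Context {R : realType}.
Implicit Types x y c : R.

Lemma ln_ge_1subV x : 0 < x -> 1 - x^-1 <= ln x.
Proof.
move=> x0; have := @le_ln1Dx _ (x^-1 - 1).
rewrite ltrBrDl subrr invr_gt0 => /(_ x0).
rewrite addrC subrK lnV ?posrE //; lra.
Qed.

(* From ln z = 2 ln (sqrt z) >= 2 (1 - 1 / sqrt z) with z = x / s. *)
Lemma xlnx_ge_sqrt x s : 0 <= x -> 0 < s ->
  2 * (x - Num.sqrt x * Num.sqrt s) <= x * ln x - x * ln s.
Proof.
rewrite le_eqVlt => /predU1P[<-|x0] s0; first by rewrite sqrtr0 !mul0r subrr mulr0.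
set a := Num.sqrt x; set r := Num.sqrt s.
have a0 : 0 < a by rewrite sqrtr_gt0.
have r0 : 0 < r by rewrite sqrtr_gt0.
have -> : x = a ^+ 2 by rewrite sqr_sqrtr // ltW.
have -> : s = r ^+ 2 by rewrite sqr_sqrtr // ltW.
have := ln_ge_1subV (divr_gt0 a0 r0); rewrite invf_div ln_div ?posrE // => h.
have := ler_wpM2l (exprn_ge0 2 (ltW a0)) h.
have -> : a ^+ 2 * (1 - r / a) = a ^+ 2 - a * r by field; rewrite gt_eqF.
by rewrite !lnXn // !mulr2n; lra.
Qed.

(* The weight c comes from (|x - y| - c (x + y))^2 >= 0; it makes the bound
   meaningful at x + y = 0 and is optimised after summation. *)
Lemma xlnx_midpoint x y c : 0 <= x -> 0 <= y ->
  (x + y) / 2 * ln ((x + y) / 2) + (2 * c * `|x - y| - c ^+ 2 * (x + y)) / 8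
    <= (x * ln x + y * ln y) / 2.
Proof.
move=> x0 y0; set s := (x + y) / 2.
have [xy0|xy0] := eqVneq (x + y) 0.
  have -> : x = 0 by lra.
  have -> : y = 0 by lra.
  by rewrite /s xy0 !(mul0r, addr0, subrr, normr0, mulr0, oppr0).
have s0 : 0 < s by rewrite divr_gt0 // lt_neqAle eq_sym xy0 addr_ge0.
have hx := xlnx_ge_sqrt x0 s0; have hy := xlnx_ge_sqrt y0 s0.
set a : R := Num.sqrt x in hx; set b : R := Num.sqrt y in hy.
set r : R := Num.sqrt s in hx hy.
have ea : x = a ^+ 2 by rewrite sqr_sqrtr.
have eb : y = b ^+ 2 by rewrite sqr_sqrtr.
have er : s = r ^+ 2 by rewrite sqr_sqrtr // ltW.
have a0 : 0 <= a by exact: sqrtr_ge0.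
have b0 : 0 <= b by exact: sqrtr_ge0.
have r0 : 0 < r by rewrite sqrtr_gt0.
have s16 : 0 < 16 * s by lra.
have key : (2 * c * `|x - y| - c ^+ 2 * (x + y)) / 8 <= 2 * s - r * (a + b).
  (* The left bound is the square of [|x - y| - 2 c s]. The right one factors [(x - y)^2] as
     [(a + b)^2 (a - b)^2] and uses [a + b <= 2 r] with the parallelogram law
     [(a - b)^2 = 4 r^2 - (a + b)^2]. *)
  apply: (@le_trans _ _ ((x - y) ^+ 2 / (16 * s))).
    rewrite ler_pdivlMr //.
    have -> : (x - y) ^+ 2 = `|x - y| ^+ 2 by rewrite real_normK ?num_real.
    have -> : x + y = 2 * s by rewrite /s; field.
    have := sqr_ge0 (`|x - y| - 2 * c * s); nra.
  rewrite ler_pdivrMr //.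
  have S2r : a + b <= 2 * r.
    rewrite -(@ler_pXn2r _ 2) ?nnegrE ?addr_ge0 ?mulr_ge0 ?(ltW r0) //.
    by have := sqr_ge0 (a - b); rewrite /s in er; nra.
  have d2 : (a - b) ^+ 2 = (2 * r - (a + b)) * (2 * r + (a + b)).
    by rewrite /s in er; nra.
  have e1 : (x - y) ^+ 2 = (a + b) ^+ 2 * (a - b) ^+ 2 by rewrite ea eb; ring.
  have h1 : (a + b) ^+ 2 * (2 * r + (a + b)) <= (2 * r) ^+ 2 * (4 * r).
    by rewrite ler_pM ?sqr_ge0 ?addr_ge0 ?mulr_ge0 ?(ltW r0) ?lerXn2r ?nnegrE
      ?addr_ge0 ?mulr_ge0 ?(ltW r0) //; lra.
  rewrite e1 d2 mulrCA er.
  have -> : (2 * r ^+ 2 - r * (a + b)) * (16 * r ^+ 2) =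
    (2 * r - (a + b)) * ((2 * r) ^+ 2 * (4 * r)) by ring.
  by rewrite ler_wpM2l // subr_ge0.
have -> : x * ln x + y * ln y = (x * ln x - x * ln s) + (y * ln y - y * ln s) + 2 * s * ln s.
  by rewrite /s; field.
have : x + y = 2 * s by rewrite /s; field.
nra.
Qed.

End Entropy.

(** * Transport costs on the simplex *)

Section Transport.
Context {R : realType} {n : nat}.
Implicit Types (C pi : 'M[R]_n) (p q : 'rV[R]_n) (gamma : R).

Lemma simplex_midpoint p p' :
  simplex p -> simplex p' -> simplex (2^-1 *: (p + p')).
Proof.
move=> [p0 p1] [p'0 p'1]; split=> [j|].
  by rewrite !mxE mulr_ge0 ?addr_ge0.
under eq_bigr do rewrite !mxE.
rewrite -mulr_sumr big_split /= p1 p'1; lra.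
Qed.

Lemma inner_simplex_midpoint rho p p' :
  inner_simplex rho p -> inner_simplex rho p' ->
  inner_simplex rho (2^-1 *: (p + p')).
Proof.
move=> [sp hp] [sp' hp']; split=> [|j]; first exact: simplex_midpoint.
by rewrite !mxE; have := hp j; have := hp' j; lra.
Qed.

Lemma couplings_midpoint p p' q pi pi' :
  couplings p q pi -> couplings p' q pi' ->
  couplings (2^-1 *: (p + p')) q (2^-1 *: (pi + pi')).
Proof.
move=> [pi0 pir pic] [pi'0 pi'r pi'c]; split=> [i j|i|j].
- by rewrite !mxE mulr_ge0 ?addr_ge0.
- by under eq_bigr do rewrite !mxE; rewrite -mulr_sumr big_split /= pir pi'r !mxE.
- under eq_bigr do rewrite !mxE.
  by rewrite -mulr_sumr big_split /= pic pi'c; lra.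
Qed.

Lemma couplings_prod p q :
  simplex p -> simplex q -> couplings p q (\matrix_(i, j) (p 0 i * q 0 j)).
Proof.
move=> [p0 p1] [q0 q1]; split=> [i j|i|j].
- by rewrite mxE mulr_ge0.
- by under eq_bigr do rewrite mxE; rewrite -mulr_sumr q1 mulr1.
- by under eq_bigr do rewrite mxE; rewrite -mulr_suml p1 mul1r.
Qed.

Lemma couplings_tr p q pi : couplings p q pi -> couplings q p pi^T.
Proof.
move=> [pi0 pir pic]; split=> [i j|i|j]; first by rewrite mxE.
- by under eq_bigr do rewrite mxE; exact: pic.
- by under eq_bigr do rewrite mxE; exact: pir.
Qed.

Lemma couplings_sum p q pi :
  simplex p -> couplings p q pi -> \sum_i \sum_j pi i j = 1.
Proof. by move=> [_ p1] [_ pir _]; under eq_bigr do rewrite pir. Qed.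

Lemma couplings_le1 p q pi i j :
  simplex p -> couplings p q pi -> pi i j <= 1.
Proof.
move=> sp cpi; rewrite -(couplings_sum sp cpi); have [pi0 _ _] := cpi.
rewrite (bigD1 i) //= (bigD1 j) //= -addrA lerDl addr_ge0 ?sumr_ge0 //.
by move=> k _; rewrite sumr_ge0.
Qed.

Lemma couplings_simplex p q pi : simplex p -> couplings p q pi -> simplex q.
Proof.
move=> sp cpi; have [pi0 _ pic] := cpi; split=> [j|].
  by rewrite -pic sumr_ge0.
by under eq_bigr do rewrite -pic; rewrite exchange_big; exact: couplings_sum cpi.
Qed.

Lemma mxdotDr (A B B' : 'M[R]_n) : mxdot A (B + B') = mxdot A B + mxdot A B'.
Proof.
rewrite /mxdot -big_split /=; apply: eq_bigr => i _; rewrite -big_split /=.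
by apply: eq_bigr => j _; rewrite mxE mulrDr.
Qed.

Lemma mxdotZr (A B : 'M[R]_n) a : mxdot A (a *: B) = a * mxdot A B.
Proof.
rewrite /mxdot mulr_sumr; apply: eq_bigr => i _; rewrite mulr_sumr.
by apply: eq_bigr => j _; rewrite mxE mulrCA.
Qed.

Lemma mxdot_tr (A B : 'M[R]_n) : mxdot A^T B^T = mxdot A B.
Proof.
rewrite /mxdot exchange_big; apply: eq_bigr => i _.
by apply: eq_bigr => j _; rewrite !mxE.
Qed.

Lemma mxdot_ge0 (A B : 'M[R]_n) :
  (forall i j, 0 <= A i j) -> (forall i j, 0 <= B i j) -> 0 <= mxdot A B.
Proof.
by move=> A0 B0; rewrite sumr_ge0 // => i _; rewrite sumr_ge0 // => j _; rewrite mulr_ge0.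
Qed.

Lemma entropy_le0 p q pi :
  simplex p -> couplings p q pi -> mxdot pi (map_mx (@ln R) pi) <= 0.
Proof.
move=> sp cpi; have [pi0 _ _] := cpi.
rewrite sumr_le0 // => i _; rewrite sumr_le0 // => j _.
by rewrite mxE mulr_ge0_le0 // ln_le0 // (couplings_le1 i j sp cpi).
Qed.

(* Gibbs' inequality against the uniform distribution on n * n points. *)
Lemma entropy_ge p q pi : simplex p -> couplings p q pi ->
  - (2 * ln n%:R) <= mxdot pi (map_mx (@ln R) pi).
Proof.
move=> sp cpi; have [pi0 _ _] := cpi; have [_ p1] := sp.
have n0 : (0 < n)%N.
  case: (posnP n) => // n0; move: p1; rewrite big1 => [/esym/eqP|j _].
    by rewrite oner_eq0.
  by have := ltn_ord j; rewrite {2}n0.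
have N0 : 0 < n%:R :> R by rewrite ltr0n.
have gibbs i j : pi i j - (n%:R ^+ 2)^-1 - 2 * ln n%:R * pi i j
    <= pi i j * ln (pi i j).
  have := pi0 i j; rewrite le_eqVlt => /predU1P[<-|x0].
    by rewrite !(mul0r, mulr0) subr0 sub0r oppr_le0 invr_ge0 sqr_ge0.
  have := ln_ge_1subV (mulr_gt0 x0 (exprn_gt0 2 N0)).
  rewrite lnM ?posrE ?exprn_gt0 // lnXn // => h.
  have := ler_wpM2l (ltW x0) h.
  rewrite mulr2n invfM mulrBr mulr1 mulrA divff ?gt_eqF // mul1r; lra.
apply: (@le_trans _ _ (\sum_i \sum_j
    (pi i j - (n%:R ^+ 2)^-1 - 2 * ln n%:R * pi i j))).
  under eq_bigr do rewrite sumrB -mulr_sumr sumrB sumr_const card_ord.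
  rewrite sumrB -mulr_sumr sumrB sumr_const card_ord (couplings_sum sp cpi).
  have -> : (n%:R ^+ 2)^-1 *+ n *+ n = 1 :> R.
    by rewrite -[_ *+ n]mulr_natr -[_ *+ n]mulr_natr; field; rewrite gt_eqF.
  lra.
by apply: ler_sum => i _; apply: ler_sum => j _; rewrite mxE.
Qed.

(** Facts about [W] are read off from those about [Wreg] at [gamma = 0]. *)
Lemma W_Wreg0 C p q : W C p q = Wreg 0 C p q.
Proof. by congr inf; apply: eq_imagel => pi _; rewrite mul0r addr0. Qed.

(** Transposing a coupling swaps its marginals and keeps both its entropy and, [C] being symmetric,
    its cost. *)
Lemma Wreg_sym gamma C p q : C^T = C -> Wreg gamma C p q = Wreg gamma C q p.
Proof.
move=> CT; rewrite /Wreg; congr inf.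
suff sub p1 q1 : [set mxdot C pi + gamma * mxdot pi (map_mx (@ln R) pi)
      | pi in couplings p1 q1] `<=` [set mxdot C pi + gamma *
      mxdot pi (map_mx (@ln R) pi) | pi in couplings q1 p1].
  by apply/seteqP; split; exact: sub.
move=> _ [pi cpi <-]; exists pi^T; first exact: couplings_tr.
by rewrite -map_trmx -{1}CT !mxdot_tr.
Qed.

Lemma W_sym C p q : C^T = C -> W C p q = W C q p.
Proof. by move=> CT; rewrite !W_Wreg0 Wreg_sym. Qed.

(** There is no coupling in this case, and [inf] of the empty set is 0. This settles the
    measurability of [W C p] off the simplex. *)
Lemma W_out C p q : simplex p -> ~ simplex q -> W C p q = 0.
Proof.
move=> sp nsq; rewrite /W (_ : couplings p q = set0) ?image_set0 ?inf0 //.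
by apply/seteqP; split=> // pi /(couplings_simplex sp).
Qed.

Section Cost.
Variables (C : 'M[R]_n).
Hypothesis C0 : cost_matrix C.

Lemma cost_le_norm i j : C i j <= `|C|.
Proof.
have [_ Cp] := C0; rewrite -[C i j]ger0_norm //.
by rewrite /Num.norm /= mx_normrE; apply: le_bigmax (i, j).
Qed.

Lemma mxdot_le_norm (A : 'M[R]_n) : (forall i j, 0 <= A i j) ->
  mxdot C A <= `|C| * \sum_i \sum_j A i j.
Proof.
move=> A0; rewrite mulr_sumr ler_sum // => i _; rewrite mulr_sumr ler_sum // => j _.
by rewrite ler_wpM2r // cost_le_norm.
Qed.

Lemma Wreg_has_lbound gamma p q : simplex p -> 0 <= gamma ->
  has_lbound [set mxdot C pi + gamma * mxdot pi (map_mx (@ln R) pi)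
             | pi in couplings p q].
Proof.
move=> sp g0; exists (- (gamma * (2 * ln n%:R))) => _ [pi cpi <-].
have [pi0 _ _] := cpi; have [_ Cp] := C0.
have := ler_wpM2l g0 (entropy_ge sp cpi); have := mxdot_ge0 Cp pi0; lra.
Qed.

Lemma Wreg_le gamma p q pi : simplex p -> 0 <= gamma -> couplings p q pi ->
  Wreg gamma C p q <= mxdot C pi + gamma * mxdot pi (map_mx (@ln R) pi).
Proof. by move=> sp g0 cpi; apply: (ge_inf (Wreg_has_lbound _ sp g0)); exists pi. Qed.

(** Couplings optimal up to [e] stand in for minimizers; [e] is arbitrary wherever this is
    applied. *)
Lemma Wreg_approx gamma p q e : simplex p -> simplex q -> 0 <= gamma -> 0 < e ->
  exists2 pi, couplings p q pi &
    mxdot C pi + gamma * mxdot pi (map_mx (@ln R) pi) <= Wreg gamma C p q + e.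
Proof.
move=> sp sq g0 e0.
have /(inf_adherent e0)[_ [pi cpi <-] /ltW le] : has_inf
    [set mxdot C pi + gamma * mxdot pi (map_mx (@ln R) pi) | pi in couplings p q].
  split; last exact: Wreg_has_lbound.
  by apply/image_nonempty; eexists; exact: couplings_prod sp sq.
by exists pi.
Qed.

Lemma W_le p q pi : simplex p -> couplings p q pi -> W C p q <= mxdot C pi.
Proof.
by move=> sp cpi; rewrite W_Wreg0; have := Wreg_le sp (lexx 0) cpi; rewrite mul0r addr0.
Qed.

Lemma W_approx p q e : simplex p -> simplex q -> 0 < e ->
  exists2 pi, couplings p q pi & mxdot C pi <= W C p q + e.
Proof.
move=> sp sq e0; have [pi cpi] := Wreg_approx sp sq (lexx 0) e0.
by rewrite mul0r addr0 -W_Wreg0; exists pi.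
Qed.

Lemma W_ge0 p q : 0 <= W C p q.
Proof.
have [_ Cp] := C0.
have [cpq0|/set0P[pi cpi]] := eqVneq (couplings p q) set0.
  by rewrite /W cpq0 image_set0 inf0.
apply: lb_le_inf; first by exists (mxdot C pi), pi.
move=> _ [pi' [pi'0 _ _] <-]; exact: mxdot_ge0.
Qed.

Lemma Wreg_leW gamma p q : simplex p -> simplex q -> 0 <= gamma ->
  Wreg gamma C p q <= W C p q.
Proof.
move=> sp sq g0; apply/ler_addgt0Pr => e e0.
have [pi cpi le] := W_approx sp sq e0.
have := Wreg_le sp g0 cpi; have := ler_wpM2l g0 (entropy_le0 sp cpi); lra.
Qed.

Lemma W_leWreg gamma p q : simplex p -> simplex q -> 0 <= gamma ->
  W C p q <= Wreg gamma C p q + gamma * (2 * ln n%:R).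
Proof.
move=> sp sq g0; apply/ler_addgt0Pr => e e0.
have [pi cpi le] := Wreg_approx sp sq g0 e0.
have := W_le sp cpi; have := ler_wpM2l g0 (entropy_ge sp cpi); lra.
Qed.

(* Entropy is strongly convex in the l1-norm, and marginalisation does not
   increase the l1-norm. *)
Lemma Wreg_midpoint gamma p p' q :
  simplex p -> simplex p' -> simplex q -> 0 <= gamma ->
  Wreg gamma C (2^-1 *: (p + p')) q <=
    (Wreg gamma C p q + Wreg gamma C p' q) / 2
      - gamma / 16 * l2norm (p - p') ^+ 2.
Proof.
move=> sp sp' sq g0; apply/ler_addgt0Pr => e e0.
have [pi cpi le] := Wreg_approx sp sq g0 e0.
have [pi' cpi' le'] := Wreg_approx sp' sq g0 e0.
have [pi0 pir _] := cpi; have [pi'0 pi'r _] := cpi'.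
apply: (le_trans (Wreg_le (simplex_midpoint sp sp') g0
  (couplings_midpoint cpi cpi'))).
rewrite mxdotZr mxdotDr.
set S := \sum_i \sum_j `|pi i j - pi' i j|.
have lS : l2norm (p - p') ^+ 2 <= S ^+ 2.
  have S0 : 0 <= S by rewrite sumr_ge0 // => i _; rewrite sumr_ge0.
  rewrite lerXn2r ?nnegrE ?l2norm_ge0 // (le_trans (l2norm_le_sum_norm _)) //.
  apply: ler_sum => i _; rewrite !mxE -pir -pi'r -sumrB.
  exact: ler_norm_sum.
have ent : mxdot (2^-1 *: (pi + pi')) (map_mx (@ln R) (2^-1 *: (pi + pi')))
  <= (mxdot pi (map_mx (@ln R) pi) + mxdot pi' (map_mx (@ln R) pi')) / 2
      - S ^+ 2 / 16.
  (* Both couplings have mass 1, so the summed gain is [(2 c S - 2 c^2) / 8]; it is maximal at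
     [c = S / 2], with value [S^2 / 16]. *)
  set c := S / 2.
  have -> : S ^+ 2 / 16 = \sum_i \sum_j ((2 * c * `|pi i j - pi' i j|
      - c ^+ 2 * (pi i j + pi' i j)) / 8).
    under eq_bigr do rewrite -mulr_suml sumrB -!mulr_sumr big_split /=.
    rewrite -mulr_suml sumrB -!mulr_sumr big_split /=.
    rewrite (couplings_sum sp cpi) (couplings_sum sp' cpi') -/S /c; by field.
  rewrite lerBrDr /mxdot -!big_split /= mulr_suml; apply: ler_sum => i _.
  rewrite -!big_split /= mulr_suml; apply: ler_sum => j _.
  rewrite !mxE [2^-1 * _]mulrC; exact: xlnx_midpoint.
have := ler_wpM2l g0 ent; have := ler_wpM2l g0 lS; lra.
Qed.

(* An optimal coupling of (p', q) is turned into one of (p, q): shrink its rows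
   to min(p, p') and redistribute the missing mass by a product coupling. *)
Lemma W_le_norm p p' q : simplex p -> simplex p' -> simplex q ->
  W C p q <= W C p' q + `|C| * \sum_i `|p 0 i - p' 0 i|.
Proof.
move=> sp sp' sq; apply/ler_addgt0Pr => e e0.
have [pi cpi le] := W_approx sp' sq e0.
have [pi0 pir pic] := cpi; have [p0 p1] := sp; have [p'0 p'1] := sp'.
have [q0 q1] := sq.
pose k i := Num.min (p 0 i) (p' 0 i).
have kp i : k i <= p 0 i by rewrite ge_min lexx.
have kp' i : k i <= p' 0 i by rewrite ge_min lexx orbT.
have k0 i : 0 <= k i by rewrite le_min p0 p'0.
(* If [p' 0 i = 0], the quotient is 0 by convention, in agreement with [k i = 0]. *)
pose pi1 := \matrix_(i, j) (k i / p' 0 i * pi i j).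
have pi1r i : \sum_j pi1 i j = k i.
  under eq_bigr do rewrite mxE; rewrite -mulr_sumr pir.
  have [p'i0|p'i0] := eqVneq (p' 0 i) 0; last by rewrite divfK.
  by rewrite p'i0 mulr0; apply/esym/le_anti; rewrite k0 andbT -p'i0.
have pi10 i j : 0 <= pi1 i j by rewrite mxE mulr_ge0 ?divr_ge0.
have pi1_le i j : pi1 i j <= pi i j.
  rewrite mxE ler_piMl //; have := p'0 i; rewrite le_eqVlt => /predU1P[<-|h].
    by rewrite invr0 mulr0.
  by rewrite ler_pdivrMr // mul1r.
pose d j := q 0 j - \sum_i pi1 i j.
have d0 j : 0 <= d j by rewrite subr_ge0 -pic ler_sum.
pose D := \sum_i (p 0 i - k i).
have dD : \sum_j d j = D.
  rewrite sumrB q1 exchange_big /D sumrB p1; congr (_ - _).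
  exact: eq_bigr.
have pk0 i : 0 <= p 0 i - k i by rewrite subr_ge0.
have D0 : 0 <= D by exact: sumr_ge0.
(* Product of the row deficits and the column deficits, both of total mass [D]. If [D = 0], all
   deficits vanish and division by zero gives the right matrix 0. *)
pose E := \matrix_(i, j) ((p 0 i - k i) * d j / D).
have E0 i j : 0 <= E i j by rewrite mxE divr_ge0 // mulr_ge0.
have Er i : \sum_j E i j = p 0 i - k i.
  under eq_bigr do rewrite mxE; rewrite -mulr_suml -mulr_sumr dD.
  have [Dz|Dz] := eqVneq D 0; last by rewrite mulfK.
  by rewrite (psumr_eq0P _ Dz) // !mul0r.
have Ec j : \sum_i E i j = d j.
  under eq_bigr do rewrite mxE; rewrite -mulr_suml -mulr_suml -/D.
  have [Dz|Dz] := eqVneq D 0; last by rewrite mulrAC divff // mul1r.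
  by rewrite (psumr_eq0P _ (etrans dD Dz)) // mulr0 mul0r.
have cpl : couplings p q (pi1 + E).
  split=> [i j|i|j]; first by rewrite mxE addr_ge0.
  - by under eq_bigr do rewrite mxE; rewrite big_split /= pi1r Er addrC subrK.
  - by under eq_bigr do rewrite mxE; rewrite big_split /= Ec addrC subrK.
apply: (le_trans (W_le sp cpl)); rewrite mxdotDr addrAC lerD //.
  apply: le_trans le; apply: ler_sum => i _; apply: ler_sum => j _.
  by have [_ Cp] := C0; rewrite ler_wpM2l.
apply: (le_trans (mxdot_le_norm E0)); rewrite ler_wpM2l //.
apply: ler_sum => i _; rewrite Er /k.
by case: (leP (p 0 i) (p' 0 i)) => _; rewrite ?subrr ?ler_norm.
Qed.

(** Valid on the whole simplex, hence applicable to the approximate minimizer [phat w], which is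
    only known to lie there. *)
Lemma W_lipschitz p p' q : simplex p -> simplex p' -> simplex q ->
  W C p q - W C p' q <= Num.sqrt n%:R * `|C| * l2norm (p - p').
Proof.
move=> sp sp' sq; rewrite lerBlDl (le_trans (W_le_norm sp sp' sq)) // lerD2l.
rewrite [Num.sqrt _ * _]mulrC -mulrA ler_wpM2l //.
apply: le_trans (sum_norm_le_l2norm _); apply: ler_sum => i _.
by rewrite !mxE.
Qed.

End Cost.
End Transport.

(** * Stability on a finite sample space *)

Lemma avg_const (R : realType) m (x : R) :
  (0 < m)%N -> m%:R^-1 * \sum_(i < m) x = x.
Proof.
move=> m0; rewrite sumr_const card_ord -[x *+ m]mulr_natl mulrA mulVf ?mul1r //.
by rewrite pnatr_eq0 -lt0n.
Qed.

Section FiniteSample.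
Context {R : realType} {T : finType} (mu : T -> R) {m : nat}.
Hypotheses (mu0 : forall t, 0 <= mu t) (mu1 : \sum_t mu t = 1).
Local Notation sample := {ffun 'I_m -> T}.

Definition prod_mass (s : sample) : R := \prod_i mu (s i).

Definition replace_at (s : sample) i t : sample :=
  [ffun j => if j == i then t else s j].

Lemma prod_mass_ge0 s : 0 <= prod_mass s.
Proof. by apply: prodr_ge0. Qed.

Lemma prod_mass_sum1 : \sum_s prod_mass s = 1.
Proof.
by have <- := bigA_distr_bigA (fun (_ : 'I_m) t => mu t); rewrite big1.
Qed.

(* (s, t) |-> (replace_at s i t, s i) is a measure preserving involution. *)
Lemma sum_prod_mass_swap i (g : sample -> T -> R) :
  \sum_s prod_mass s * g s (s i) =
  \sum_s \sum_t prod_mass s * mu t * g (replace_at s i t) t.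
Proof.
have -> : \sum_s prod_mass s * g s (s i) =
    \sum_s \sum_t prod_mass s * mu t * g s (s i).
  by apply: eq_bigr => s _; rewrite -mulr_suml -mulr_sumr mu1 mulr1.
rewrite !pair_bigA /=.
pose h (x : sample * T) := (replace_at x.1 i x.2, x.1 i).
have hK : involutive h.
  move=> [s t]; rewrite /h /= ffunE eqxx; congr (_, _).
  by apply/ffunP => j; rewrite !ffunE; case: eqP => [->|].
rewrite (reindex_inj (inv_inj hK)); apply: eq_bigr => -[s t] _ /=.
rewrite ffunE eqxx; congr (_ * _).
rewrite /prod_mass (bigD1 i) //= [in RHS](bigD1 i) //= ffunE eqxx.
rewrite (eq_bigr (fun j => mu (s j))); first by ring.
by move=> j /negPf ji; rewrite ffunE ji.
Qed.

Lemma sum_prod_mass_coord i (f : T -> R) :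
  \sum_s prod_mass s * f (s i) = \sum_t mu t * f t.
Proof.
rewrite (sum_prod_mass_swap i (fun _ => f)).
under eq_bigr do [under eq_bigr do rewrite -mulrA; rewrite -mulr_sumr].
by rewrite -mulr_suml prod_mass_sum1 mul1r.
Qed.

Lemma finite_markov (X : sample -> R) (a b : R) :
  0 < a -> (forall s, 0 <= X s) -> \sum_s prod_mass s * X s <= b * a ->
  1 - b <= \sum_(s | X s <= a) prod_mass s.
Proof.
move=> a0 X0 le; have := prod_mass_sum1.
rewrite (bigID (fun s => X s <= a)) /= => /esym E; rewrite {1}E.
suff : \sum_(s | ~~ (X s <= a)) prod_mass s <= b by lra.
rewrite -(ler_pM2r a0); apply: le_trans le; rewrite mulr_suml.
rewrite [leRHS](bigID (fun s => X s <= a)) /= -[leLHS]add0r lerD //.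
  by rewrite sumr_ge0 // => s _; rewrite mulr_ge0 // prod_mass_ge0.
by apply: ler_sum => s; rewrite -ltNge => /ltW ?; rewrite ler_wpM2l // prod_mass_ge0.
Qed.

(** * Algorithmic stability of empirical risk minimization *)

Section Stability.
Context {n : nat} (A : set 'rV[R]_n) (loss : 'rV[R]_n -> T -> R).
Variables (M kappa delta tau : R) (phat : sample -> 'rV[R]_n).
Hypotheses (A_midpoint : forall p p', A p -> A p' -> A (2^-1 *: (p + p')))
  (loss_lip : forall t, lipschitz_l2 A M (loss ^~ t))
  (loss_midpoint : forall p p' t, A p -> A p' ->
     loss (2^-1 *: (p + p')) t <=
       (loss p t + loss p' t) / 2 - kappa * l2norm (p - p') ^+ 2).

Definition emp_loss (s : sample) p : R := m%:R^-1 * \sum_i loss p (s i).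
Definition pop_loss p : R := \sum_t mu t * loss p t.

Hypotheses (M0 : 0 <= M) (kappa0 : 0 < kappa) (tau0 : 0 < tau) (m0 : (0 < m)%N)
  (delta_tau : 3 * delta <= 2 * kappa * tau ^+ 2)
  (phatA : forall s, A (phat s))
  (phat_min : forall s p, A p -> emp_loss s (phat s) <= emp_loss s p + delta).

Lemma emp_loss_midpoint s p p' : A p -> A p' ->
  emp_loss s (2^-1 *: (p + p')) <=
    (emp_loss s p + emp_loss s p') / 2 - kappa * l2norm (p - p') ^+ 2.
Proof.
move=> Ap Ap'; rewrite /emp_loss.
have mR : 0 < m%:R :> R by rewrite ltr0n.
have -> : kappa * l2norm (p - p') ^+ 2 =
    m%:R^-1 * \sum_(i < m) kappa * l2norm (p - p') ^+ 2.
  by rewrite avg_const.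
rewrite -mulrDr -mulrA -mulrBr ler_pM2l ?invr_gt0 //.
by rewrite -big_split mulr_suml -sumrB; apply: ler_sum => i _; exact: loss_midpoint.
Qed.

(** The midpoint cannot beat [p] by more than [delta], while strong convexity puts it [kappa] times
    the squared distance below the average of the two losses. *)
Lemma near_minimizer_dist s p p' b : A p -> A p' ->
  (forall x, A x -> emp_loss s p <= emp_loss s x + delta) ->
  emp_loss s p' <= emp_loss s p + b ->
  2 * kappa * l2norm (p - p') ^+ 2 <= b + 2 * delta.
Proof.
move=> Ap Ap' pmin le.
have := emp_loss_midpoint s Ap Ap'; have := pmin _ (A_midpoint Ap Ap'); lra.
Qed.

(** With [a = M / m], the two empirical losses differ by two terms, each changing by at most [a D]
    between [p] and [p']. Hence [p'] is optimal for [s] up to [delta + 2 a D], and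
    [near_minimizer_dist] gives [2 kappa D^2 <= 2 a D + 3 delta]. The slack [tau] absorbs [delta]:
    if [D > a / kappa + tau], the left side would exceed [2 a D + 2 kappa tau^2], contradicting
    [delta_tau]. *)
Lemma phat_stable s i t :
  l2norm (phat s - phat (replace_at s i t)) <= M / (kappa * m%:R) + tau.
Proof.
set s' := replace_at s i t; set p := phat s; set p' := phat s'.
set D := l2norm _; have D0 : 0 <= D by exact: l2norm_ge0.
have mR : 0 < m%:R :> R by rewrite ltr0n.
have emp_diff x : emp_loss s x - emp_loss s' x =
    m%:R^-1 * (loss x (s i) - loss x t).
  rewrite /emp_loss -mulrBr -sumrB (bigD1 i) //= ffunE eqxx big1 ?addr0 //.
  by move=> j /negPf ji; rewrite ffunE ji subrr.
set a := M / m%:R.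
have lip u : m%:R^-1 * (loss p' u - loss p u) <= a * D.
  rewrite mulrC /a [M / _ * _]mulrAC ler_pM2r ?invr_gt0 //.
  by rewrite /D l2normB (le_trans (ler_norm _)) // loss_lip //; exact: phatA.
have lip' u : m%:R^-1 * (loss p u - loss p' u) <= a * D.
  rewrite mulrC /a [M / _ * _]mulrAC ler_pM2r ?invr_gt0 //.
  by rewrite /D (le_trans (ler_norm _)) // loss_lip //; exact: phatA.
have h : 2 * kappa * D ^+ 2 <= (delta + 2 * a * D) + 2 * delta.
  apply: (near_minimizer_dist (s := s)) => //; try exact: phatA.
    by move=> x Ax; exact: phat_min.
  have := phat_min s' (phatA s); rewrite -/p -/p'.
  have := emp_diff p; have := emp_diff p'; have := lip (s i); have := lip' t.
  rewrite !mulrBr; lra.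
have -> : M / (kappa * m%:R) = a / kappa by rewrite invfM mulrA mulrAC.
rewrite leNgt; apply/negP => lt.
have a0 : 0 <= a by rewrite divr_ge0 // ltW.
have lt' : a + kappa * tau < kappa * D.
  by rewrite -(ltr_pM2l kappa0) mulrDr mulrCA divff ?gt_eqF // mulr1 in lt.
have tD : tau <= D.
  by rewrite (le_trans _ (ltW lt)) // lerDr divr_ge0 // ltW.
have kt0 : 0 < kappa * tau by exact: mulr_gt0.
have Dp : 0 < D by exact: lt_le_trans tD.
have := ler_wpM2l (ltW kt0) tD; rewrite -(ltr_pM2l Dp) in lt'.
have := delta_tau; lra.
Qed.

(** By the swap, the expected loss of [phat s] at its own sample [s i] is that of
    [phat (replace_at s i t)] at the fresh point [t]. Stability and the Lipschitz bound compare it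
    with the loss of [phat s] at [t]. *)
Lemma erm_generalization :
  \sum_s prod_mass s * pop_loss (phat s) <=
  \sum_s prod_mass s * emp_loss s (phat s) + M * (M / (kappa * m%:R) + tau).
Proof.
have mR : 0 < m%:R :> R by rewrite ltr0n.
set B := M * _.
have -> : \sum_s prod_mass s * emp_loss s (phat s) =
    m%:R^-1 * \sum_i \sum_s prod_mass s * loss (phat s) (s i).
  rewrite exchange_big mulr_sumr; apply: eq_bigr => s _.
  by rewrite /emp_loss mulrCA mulr_sumr.
have -> : \sum_s prod_mass s * pop_loss (phat s) =
    m%:R^-1 * \sum_(i < m) \sum_s prod_mass s * pop_loss (phat s).
  by rewrite avg_const.
have -> : B = m%:R^-1 * \sum_(i < m) B.
  by rewrite avg_const.
rewrite -mulrDr ler_pM2l ?invr_gt0 // -big_split; apply: ler_sum => i _ /=.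
rewrite (sum_prod_mass_swap i (fun s => loss (phat s))).
have -> : B = \sum_s \sum_t prod_mass s * mu t * B.
  rewrite -[LHS]mul1r -[X in X * _]prod_mass_sum1 mulr_suml.
  by apply: eq_bigr => s _; rewrite -mulr_suml -mulr_sumr mu1 mulr1.
rewrite -big_split; apply: ler_sum => s _ /=.
rewrite -big_split mulr_sumr; apply: ler_sum => t _ /=.
rewrite -mulrDr mulrA ler_wpM2l ?mulr_ge0 ?prod_mass_ge0 // -lerBlDl.
rewrite (le_trans (ler_norm _)) // (le_trans (loss_lip _ (phatA _) (phatA _))) //.
by rewrite ler_wpM2l // phat_stable.
Qed.

Lemma pop_loss_sum p : \sum_s prod_mass s * emp_loss s p = pop_loss p.
Proof.
rewrite -[RHS](@avg_const _ m) // mulr_sumr.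
under eq_bigr => s _ do rewrite /emp_loss mulrCA mulr_sumr mulr_sumr.
rewrite exchange_big; apply: eq_bigr => i _ /=.
by rewrite -mulr_sumr (sum_prod_mass_coord i (loss p)).
Qed.

(** The reference value [v] is any bound on the expected empirical loss of [phat]. It may therefore
    come from a competitor outside [A], and even from another loss. *)
Lemma erm_excess_prob (a b v : R) : 0 < a ->
  M * (M / (kappa * m%:R) + tau) + delta <= b * a ->
  \sum_s prod_mass s * emp_loss s (phat s) <= v ->
  1 - b <= \sum_(s | pop_loss (phat s) <=
      v + M * (M / (kappa * m%:R) + tau) + a) prod_mass s.
Proof.
move=> a0; set B := M * _ => Bab empv.
have gen := erm_generalization.
have [s0 _] : exists s0 : sample, true.
  apply: contrapT => h; have := prod_mass_sum1; rewrite big1 => [/esym/eqP|s _].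
    by rewrite oner_eq0.
  by case: h; exists s.
(* Markov's inequality requires a nonnegative variable. The least value [I] of [pop_loss (phat s)],
   attained because there are finitely many samples, is subtracted. The point [phat s1] lies in [A]
   and is fixed, so its empirical loss is unbiased and bounds the mean empirical loss of [phat] by
   [I + delta]. *)
have [s1 s1min] : exists s1, forall s, pop_loss (phat s1) <= pop_loss (phat s).
  by case: (@arg_minP _ _ _ s0 predT (fun s => pop_loss (phat s)) isT) => s1 _ h;
    exists s1 => s; exact: h.
set I := pop_loss (phat s1) in s1min.
have wsum (c : R) : \sum_s prod_mass s * c = c.
  by rewrite -mulr_suml prod_mass_sum1 mul1r.
have Iv : I <= v + B.
  apply: (@le_trans _ _ (\sum_s prod_mass s * pop_loss (phat s))).
    by rewrite -[leLHS]wsum; apply: ler_sum => s _; rewrite ler_wpM2l ?prod_mass_ge0.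
  exact: le_trans gen (lerD _ _).
have empI : \sum_s prod_mass s * emp_loss s (phat s) <= I + delta.
  rewrite /I -pop_loss_sum -[delta in leRHS]wsum -big_split /=.
  apply: ler_sum => s _; rewrite -mulrDr ler_wpM2l ?prod_mass_ge0 //.
  exact/phat_min/phatA.
apply: le_trans (finite_markov (X := fun s => pop_loss (phat s) - I) (b := b) a0 _ _) _.
- by move=> s; rewrite subr_ge0.
- under eq_bigr do rewrite mulrBr.
  rewrite sumrB wsum; apply: le_trans Bab; move: gen empI; rewrite -/B; lra.
- rewrite [leLHS]big_mkcond [leRHS]big_mkcond; apply: ler_sum => s _.
  case: ifPn => [h|_]; last by case: ifP => // _; exact: prod_mass_ge0.
  by rewrite ifT //; lra.
Qed.

End Stability.
End FiniteSample.

(** * Borel sets and grid cells *)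

Lemma measure_bigcup_fintype d (T : measurableType d) (R : realType)
    (mu : {measure set T -> \bar R}) (I : finType) (E : pred I)
    (F : I -> set T) :
  (forall i, measurable (F i)) -> trivIset setT F ->
  measurable (\bigcup_(i in [set i | E i]) F i) /\
  mu (\bigcup_(i in [set i | E i]) F i) = (\sum_(i | E i) mu (F i))%E.
Proof.
move=> mF tF; have fE : finite_set [set i | E i] by exact: finite_finset.
split; first by apply: fin_bigcup_measurable => // i _; exact: mF.
rewrite measure_fin_bigcup //; last exact: sub_trivIset tF.
have -> : [set i | E i] = [set` [seq i <- index_enum I | E i]].
  by apply/seteqP; split=> i /=; rewrite mem_filter mem_index_enum andbT.
by rewrite -fsbig_seq ?filter_uniq ?index_enum_uniq // big_filter.
Qed.

Section Borel.
Context {R : realType} {n : nat}.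

Lemma open_measurable_borel_rV (U : set (borel_rV R n)) :
  open (U : set 'rV[R]_n) -> measurable U.
Proof. exact: sub_sigma_algebra. Qed.

Lemma measurable_coord (j : 'I_n) :
  measurable_fun setT (fun q : borel_rV R n => (q : 'rV[R]_n) 0 j).
Proof.
apply: (measurability _ (RGenOInfty.measurableE R)) => // _ [_ [a ->] <-].
rewrite setTI; apply: open_measurable_borel_rV.
apply: (@open_comp _ _ (fun q : 'rV[R]_n => q 0 j) `]a, +oo[).
  by move=> q _; exact: coord_continuous.
exact: interval_open.
Qed.

Lemma measurable_simplex : measurable (simplex : set (borel_rV R n)).
Proof.
have -> : (simplex : set (borel_rV R n)) =
    \bigcap_(j in [set: 'I_n]) ((fun q : borel_rV R n => (q : 'rV[R]_n) 0 j)
      @^-1` `[0, +oo[) `&`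
    ((fun q : borel_rV R n => \sum_j (q : 'rV[R]_n) 0 j) @^-1` [set 1]).
  apply/seteqP; split=> q /=.
    by move=> [q0 q1]; split=> // j _; rewrite /= in_itv /= q0.
  by move=> [q0 q1]; split=> // j; have := q0 j I; rewrite /= in_itv /= andbT.
apply: measurableI.
  apply: fin_bigcap_measurable => // j _.
  by rewrite -[_ @^-1` _]setTI; apply: measurable_coord.
rewrite -[_ @^-1` _]setTI; have : measurable_fun setT
    (fun q : borel_rV R n => \sum_j (q : 'rV[R]_n) 0 j).
  by apply: measurable_sum => j; exact: measurable_coord.
by apply.
Qed.

Lemma measurable_inner_simplex rho :
  measurable (inner_simplex rho : set (borel_rV R n)).
Proof.
have -> : (inner_simplex rho : set (borel_rV R n)) = simplex `&`
    \bigcap_(j in [set: 'I_n]) ((fun q : borel_rV R n => (q : 'rV[R]_n) 0 j)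
      @^-1` `[rho, +oo[).
  apply/seteqP; split=> q /=.
    by move=> [sq qr]; split=> // j _; rewrite /= in_itv /= qr.
  by move=> [sq qr]; split=> // j; have := qr j I; rewrite /= in_itv /= andbT.
apply: measurableI; first exact: measurable_simplex.
apply: fin_bigcap_measurable => // j _.
by rewrite -[_ @^-1` _]setTI; apply: measurable_coord.
Qed.

Lemma inner_simplex_partition (rho delta : R) : 0 < delta ->
  exists (T : finType) (cell : T -> set (borel_rV R n)),
  [/\ forall t, measurable (cell t), trivIset setT cell,
      \bigcup_(t in [set: T]) cell t = inner_simplex rho
    & forall t q q', cell t q -> cell t q' ->
        \sum_j `|(q : 'rV[R]_n) 0 j - (q' : 'rV[R]_n) 0 j| <= delta].
Proof.
(* Cells have side [1 / N] with [N > n / delta], so their l1-diameter is at most [n / N < delta].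
   The index [truncn (N q_j)] reaches [N] when [q_j = 1], hence ['I_N.+1]. *)
move=> d0; pose N := (Num.truncn (n%:R / delta)).+1.
have N0 : 0 < N%:R :> R by rewrite ltr0n.
pose cell (t : {ffun 'I_n -> 'I_N.+1}) : set (borel_rV R n) :=
  [set q | inner_simplex rho q /\
    forall j, (t j)%:R <= N%:R * (q : 'rV[R]_n) 0 j < (t j).+1%:R].
exists _, cell; split=> [t||| t q q' [_ tq] [_ tq']].
- have -> : cell t = inner_simplex rho `&` \bigcap_(j in [set: 'I_n])
      ((fun q : borel_rV R n => (q : 'rV[R]_n) 0 j)
        @^-1` `[(t j)%:R / N%:R, (t j).+1%:R / N%:R[).
    apply/seteqP; split=> q /= [iq qt]; split=> // j.
      by move=> _; rewrite /= in_itv /= ler_pdivrMr // ltr_pdivlMr // mulrC.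
    by have := qt j I; rewrite /= in_itv /= ler_pdivrMr // ltr_pdivlMr // mulrC.
  apply: measurableI; first exact: measurable_inner_simplex.
  apply: fin_bigcap_measurable => // j _.
  by rewrite -[_ @^-1` _]setTI; apply: measurable_coord.
- move=> t t' _ _ [q [[_ tq] [_ t'q]]]; apply/ffunP => j; apply/val_inj => /=.
  by rewrite -(truncn_def (tq j)) -(truncn_def (t'q j)).
- apply/seteqP; split=> [q [t _ [iq _]] //|q iq].
  have [[q0 q1] _] := iq.
  pose t : {ffun 'I_n -> 'I_N.+1} :=
    [ffun j => inord (Num.truncn (N%:R * (q : 'rV[R]_n) 0 j))].
  exists t => //; split=> // j; rewrite ffunE inordK.
    by rewrite truncn_itv // mulr_ge0.
  rewrite ltnS truncn_le_nat; apply: (@le_lt_trans _ _ N%:R); last by rewrite ltr_nat.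
  rewrite ler_piMr // -q1 (bigD1 j) //= lerDl; exact: sumr_ge0.
- apply: (@le_trans _ _ (\sum_(j < n) N%:R^-1)).
    apply: ler_sum => j _; have := tq j; have := tq' j.
    move=> /andP[a b] /andP[c d].
    rewrite -(ler_pM2l N0) divff ?gt_eqF // -[X in X * _](ger0_norm (ltW N0)).
    rewrite -normrM ler_norml mulrBr; rewrite -[(t j).+1%:R]natr1 in b d; lra.
  rewrite sumr_const card_ord -[_ *+ n]mulr_natl ler_pdivrMr // mulrC.
  by rewrite -ler_pdivrMr // ltW // truncnS_gt.
Qed.

End Borel.

(** * Measurability of the transport cost and discretization of its mean *)

Section Population.
Context {R : realType} {n : nat}.

Lemma sum_coord_norm_le (v : 'rV[R]_n) : \sum_j `|v 0 j| <= n%:R * `|v|.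
Proof.
have -> : n%:R * `|v| = \sum_(j < n) `|v|.
  by rewrite sumr_const card_ord -[`|v| *+ n]mulr_natl.
apply: ler_sum => j _.
by rewrite [`|v|]/Num.norm /= mx_normrE; apply: (le_bigmax _ _ (0, j)).
Qed.

(** Superlevel sets are relatively open: around a point where [f q > a], a ball of radius
    proportional to [f q - a] stays above [a] within [D]. *)
Lemma measurable_fun_lipschitz (D : set (borel_rV R n)) (f : 'rV[R]_n -> R) K :
  measurable D -> 0 <= K ->
  (forall q q', D q -> D q' -> f q - f q' <= K * \sum_j `|q 0 j - q' 0 j|) ->
  measurable_fun D (f : borel_rV R n -> R).
Proof.
move=> mD K0 lip.
apply: (measurability _ (RGenOInfty.measurableE R)) => // _ [_ [a ->] <-].
(* The l1-distance is at most [n] times the library norm, hence [K n]; the [+ 1] keeps the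
   denominator positive when [K n = 0]. *)
pose r q := (f q - a) / (K * n%:R + 1).
have Kn : 0 < K * n%:R + 1 by rewrite ltr_wpDl // mulr_ge0.
pose U := \bigcup_(q in [set q : 'rV[R]_n | D q /\ a < f q]) ball q (r q).
have -> : D `&` f @^-1` `]a, +oo[ = D `&` (U : set (borel_rV R n)).
  apply/seteqP; split=> q /= [Dq].
    rewrite in_itv /= andbT => aq; split=> //; exists q => //.
    by apply: ballxx; rewrite divr_gt0 // subr_gt0.
  move=> [q' [Dq' aq'] /=]; rewrite -ball_normE /= => h; split=> //.
  rewrite in_itv /= andbT; rewrite ltr_pdivlMr // in h.
  have := lip q' q Dq' Dq; have := sum_coord_norm_le (q' - q).
  under eq_bigr do rewrite !mxE.
  move=> /(ler_wpM2l K0); rewrite mulrA; have := normr_ge0 (q' - q); lra.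
apply: measurableI => //; apply: open_measurable_borel_rV.
apply: bigcup_open => q [_ aq]; exact: ball_open.
Qed.

Variables (C : 'M[R]_n).
Hypothesis C0 : cost_matrix C.

Lemma W_lipschitz_r p q q' : simplex p -> simplex q -> simplex q' ->
  W C p q - W C p q' <= `|C| * \sum_j `|q 0 j - q' 0 j|.
Proof.
have [CT _] := C0; move=> sp sq sq'; rewrite (W_sym p q CT) (W_sym p q' CT) lerBlDl.
exact: W_le_norm.
Qed.

Lemma measurable_W p : simplex p ->
  measurable_fun setT (W C p : borel_rV R n -> R).
Proof.
move=> sp; rewrite -(setUv (simplex : set (borel_rV R n))).
apply/measurable_funU; [exact: measurable_simplex| |split].
- by apply: measurableC; exact: measurable_simplex.
- apply: (measurable_fun_lipschitz _ (normr_ge0 C)).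
    exact: measurable_simplex.
  by move=> q q' sq sq'; exact: W_lipschitz_r.
- apply: (eq_measurable_fun (cst 0 : borel_rV R n -> R)) => // q; rewrite inE => nsq.
  by rewrite W_out.
Qed.

(** The cells exhaust a set of full mass, and on each of them [W C p] stays within [|C| delta] of
    its value at the representative [z t]. *)
Lemma population_W_approx (P : probability (borel_rV R n) R) (rho delta : R)
    (T : finType) (cell : T -> set (borel_rV R n)) (z : T -> 'rV[R]_n) p :
  simplex p -> 0 <= delta -> P (inner_simplex rho) = 1%E ->
  (forall t, measurable (cell t)) -> trivIset setT cell ->
  \bigcup_(t in [set: T]) cell t = inner_simplex rho ->
  (forall t, inner_simplex rho (z t)) ->
  (forall t q, cell t q ->
     \sum_j `|(q : 'rV[R]_n) 0 j - (z t) 0 j| <= delta) ->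
  `|population_W C P p - \sum_t fine (P (cell t)) * W C p (z t)|
    <= `|C| * delta.
Proof.
move=> sp d0 P1 mcell tcell cellU zin zd.
have mI := @measurable_inner_simplex R n rho.
pose f (q : borel_rV R n) : \bar R := (W C p q)%:E.
have mf : measurable_fun setT f.
  by apply/measurable_EFinP; exact: measurable_W.
have f0 q : (0 <= f q)%E by rewrite lee_fin W_ge0.
have PIc : P (~` inner_simplex rho) = 0%E.
  by rewrite probability_setC // P1 subee.
have cellI t q : cell t q -> inner_simplex rho q.
  by move=> tq; rewrite -cellU; exists t.
have Pfin t : P (cell t) = (fine (P (cell t)))%:E.
  by rewrite fineK // fin_num_measure.
have intE : (\int[P]_q f q = \sum_t \int[P]_(q in cell t) f q)%E.
  rewrite (ge0_negligible_integral _ _ mf _ PIc) //; last exact: measurableC.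
  rewrite setTD setCK -cellU.
  have -> : \bigcup_(t in [set: T]) cell t =
      \big[setU/set0]_(t <- index_enum T) cell t.
    rewrite -bigcup_seq; congr bigcup.
    by apply/seteqP; split=> t //= _; rewrite mem_index_enum.
  apply: ge0_integral_bigsetU => //; first exact: index_enum_uniq.
  - exact: sub_trivIset tcell.
  - exact: measurable_funS mf.
have Wd t q : cell t q -> `|W C p q - W C p (z t)| <= `|C| * delta.
  move=> tq; have [sq _] := cellI _ _ tq; have [sz _] := zin t.
  have le := ler_wpM2l (normr_ge0 C) (zd _ _ tq).
  have := W_lipschitz_r sp sq sz; have := W_lipschitz_r sp sz sq.
  under [X in _ * X]eq_bigr do rewrite distrC.
  rewrite ler_norml; lra.
have mfc t : measurable_fun (cell t) f by exact: measurable_funS mf.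
have Cd0 : 0 <= `|C| * delta by exact: mulr_ge0.
have up t : (\int[P]_(q in cell t) f q <=
    ((W C p (z t) + `|C| * delta) * fine (P (cell t)))%:E)%E.
  rewrite EFinM -Pfin -integral_cst //; apply: ge0_le_integral => //.
  - by move=> q tq; rewrite lee_fin; have := Wd _ _ tq; rewrite ler_norml; lra.
(* The error is added on the right, rather than subtracted on the left, to keep all integrands
   nonnegative. *)
have low t : ((W C p (z t) * fine (P (cell t)))%:E <=
    \int[P]_(q in cell t) f q + (`|C| * delta * fine (P (cell t)))%:E)%E.
  rewrite (EFinM (W C p _) _) (EFinM (`|C| * delta) _) -!Pfin -!integral_cst // -ge0_integralD //.
  apply: ge0_le_integral => //.
  - by move=> q _; rewrite lee_fin W_ge0.
  - by apply: emeasurable_funD.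
  - move=> q tq; rewrite -EFinD lee_fin; have := Wd _ _ tq.
    by rewrite ler_norml; lra.
have fin t : (\int[P]_(q in cell t) f q)%E \is a fin_num.
  rewrite ge0_fin_numE; last by apply: integral_ge0 => q _; exact: f0.
  exact: le_lt_trans (up t) (ltry _).
have sumP : \sum_t fine (P (cell t)) = 1.
  apply: EFin_inj; rewrite -sumEFin -P1 -cellU.
  have [_] := measure_bigcup_fintype P predT mcell tcell.
  rewrite (_ : [set i | predT i] = [set: T]); last by apply/seteqP.
  by move=> ->; apply: eq_bigr => t _; rewrite -Pfin.
rewrite /population_W /Rintegral intE -sum_fine //.
rewrite -sumrB -[`|C| * delta]mul1r -sumP mulr_suml (le_trans (ler_norm_sum _ _ _)) //.
apply: ler_sum => t _.
have := up t; have := low t; rewrite -(fineK (fin t)) -EFinD !lee_fin.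
rewrite ler_norml; lra.
Qed.

End Population.

Lemma near_minimizer_exists (R : realType) (V : Type) (A : set V) (f : V -> R)
    (lb delta : R) :
  A !=set0 -> (forall x, A x -> lb <= f x) -> 0 < delta ->
  exists x, A x /\ forall y, A y -> f x <= f y + delta.
Proof.
move=> A0 flb d0; have lbf : has_lbound (f @` A).
  by exists lb => _ [x Ax <-]; exact: flb.
have /(inf_adherent d0)[_ [x Ax <-] lt] : has_inf (f @` A).
  by split=> //; exact/image_nonempty.
exists x; split=> // y Ay; apply: (le_trans (ltW lt)); rewrite lerD2r.
by apply: (ge_inf lbf); exists y.
Qed.

(** * From the i.i.d. sample to the product law on cells *)

Section IidCells.
Context {R : realType} {n : nat} {d : measure_display} {Omega : measurableType d}
  (Pr : probability Omega R) {m : nat} (P : probability (borel_rV R n) R)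
  (q : 'I_m -> {RV Pr >-> borel_rV R n}) {T : finType}
  (cell : T -> set (borel_rV R n)).
Hypotheses (iid : iid_sample P q) (mcell : forall t, measurable (cell t))
  (tcell : trivIset setT cell).

Definition cell_mass t : R := fine (P (cell t)).

Definition sample_cell (s : {ffun 'I_m -> T}) : set Omega :=
  \bigcap_i (q i @^-1` cell (s i)).

Lemma measurable_sample_cell s : measurable (sample_cell s).
Proof.
apply: fin_bigcap_measurable => // i _.
by rewrite -[_ @^-1` _]setTI; apply: measurable_funPT.
Qed.

Lemma trivIset_sample_cell : trivIset setT sample_cell.
Proof.
move=> s s' _ _ [w [sw s'w]]; apply/ffunP => i.
by apply: tcell => //; exists (q i w); split; [exact: sw | exact: s'w].
Qed.

(** Independence splits the probability into factors, and the common law evaluates each; the finite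
    model thus carries the true probabilities. *)
Lemma measure_sample_cell s : Pr (sample_cell s) = (prod_mass cell_mass s)%:E.
Proof.
have [law indep] := iid; rewrite /sample_cell indep //.
rewrite /prod_mass (big_morph EFin (@EFinM R) (erefl _)).
apply: eq_bigr => i _; rewrite /cell_mass fineK ?fin_num_measure //.
by rewrite -(law i).
Qed.

(** The measurable witness is the union of the selected cells minus a null set outside which [H]
    holds. *)
Lemma with_probability_ge_cells (E : pred {ffun 'I_m -> T}) (b : R)
    (H : Omega -> Prop) :
  {ae Pr, forall w, H w} -> b <= \sum_(s | E s) prod_mass cell_mass s ->
  with_probability_ge Pr b [set w | H w /\ exists2 s, E s & sample_cell s w].
Proof.
move=> [N [mN N0 HN]] bE.
have [mU PU] := measure_bigcup_fintype Pr E measurable_sample_cell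
  trivIset_sample_cell.
set U := \bigcup_(i in _) _ in mU PU.
exists (U `\` N); split; first exact: measurableD.
  move=> w [[s Es sw] Nw]; split; last by exists s.
  by apply: contrapT => nH; apply: Nw; exact: HN.
have UN0 : Pr (U `&` N) = 0%E.
  by apply: (@subset_measure0 _ _ _ _ _ N) => //; exact: measurableI.
have := measureDI Pr mU mN : Pr U = (Pr (U `\` N) + Pr (U `&` N))%E.
rewrite UN0 adde0 => <-; rewrite PU (eq_bigr (fun s => (prod_mass cell_mass s)%:E)).
  by rewrite sumEFin lee_fin.
by move=> s _; exact: measure_sample_cell.
Qed.

(** A cell of positive probability is not contained in a null set. A statement about [s] alone that
    follows from one good outcome thus holds for every [s] of nonzero mass. *)
Lemma sample_cell_meets s (H : Omega -> Prop) :
  {ae Pr, forall w, H w} -> prod_mass cell_mass s != 0 ->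
  exists2 w, H w & sample_cell s w.
Proof.
move=> [N [mN N0 HN]] s0; apply: contrapT => h.
have : Pr (sample_cell s) = 0%E.
  apply: (@subset_measure0 _ _ _ _ _ N) => //; first exact: measurable_sample_cell.
  by move=> w sw; apply: HN => Hw; apply: h; exists w.
by rewrite measure_sample_cell => -[] /eqP; rewrite (negPf s0).
Qed.

End IidCells.

(** * Complexity *)

Section ParamBounds.
Context {R : realType}.

Lemma ln_nat_ge n : (1 < n)%N -> 2^-1 <= ln n%:R :> R.
Proof.
move=> n1; have n0 : 0 < n%:R :> R by rewrite ltr0n ltnW.
apply: le_trans (ln_ge_1subV n0).
have : n%:R^-1 <= 2^-1 :> R by rewrite lef_pV2 ?posrE // ler_nat.
lra.
Qed.

Lemma reg_paramE n (eps : R) : reg_param n eps = eps / (4 * ln n%:R).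
Proof. by rewrite /reg_param /Rsqr_entropy mulrA -natrM. Qed.

Lemma reg_param_gt0 n (eps : R) : (1 < n)%N -> 0 < eps -> 0 < reg_param n eps.
Proof.
move=> n1 e0; have l0 := ln_nat_ge n1.
by rewrite reg_paramE divr_gt0 // mulr_gt0 //; lra.
Qed.

Lemma reg_param_le n (eps : R) : (1 < n)%N -> 0 < eps -> reg_param n eps <= eps / 2.
Proof.
move=> n1 e0; have l0 := ln_nat_ge n1.
by rewrite reg_paramE ler_pM2l // lef_pV2 ?posrE //; lra.
Qed.

Lemma inner_accuracy_gt0 n c1 (C : 'M[R]_n) (eps gamma : R) :
  (0 < n)%N -> 0 < c1 -> 0 < `|C| -> 0 < eps -> 0 < gamma ->
  0 < inner_accuracy c1 C eps gamma.
Proof.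
move=> n0 c10 C0 e0 g0.
by rewrite /inner_accuracy mulr_gt0 // divr_gt0 ?mulr_gt0 ?exprn_gt0 ?ltr0n.
Qed.

Lemma sample_size_ge n c2 (C : 'M[R]_n) (beta gamma eps : R) :
  c2 * (n%:R * `|C| ^+ 2 / (beta * gamma * eps)) <=
    (sample_size c2 C beta gamma eps)%:R.
Proof.
rewrite /sample_size natr_absz (le_trans (ceil_ge _)) // ler_int.
exact: ler_norm.
Qed.

Lemma sample_size_le n c2 (C : 'M[R]_n) (beta gamma eps : R) :
  0 <= c2 * (n%:R * `|C| ^+ 2 / (beta * gamma * eps)) ->
  (sample_size c2 C beta gamma eps)%:R <=
    c2 * (n%:R * `|C| ^+ 2 / (beta * gamma * eps)) + 1.
Proof.
move=> h0; rewrite /sample_size natr_absz ger0_norm ?ceil_ge0 //; last first.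
  by rewrite (lt_le_trans _ h0) // ltrN10.
by rewrite -lerBlDr ltW // (le_lt_trans _ (ceilB1_lt _)) // rmorphB.
Qed.

Lemma norm_ln_div (x y : R) : 0 < x -> 0 < y -> `|ln (x / y)| <= `|ln x| + `|ln y|.
Proof. by move=> x0 y0; rewrite ln_div ?posrE // ler_normB. Qed.

Lemma norm_lnM (x y : R) : 0 < x -> 0 < y -> `|ln (x * y)| <= `|ln x| + `|ln y|.
Proof. by move=> x0 y0; rewrite lnM ?posrE // ler_normD. Qed.

Lemma norm_lnXn (x : R) k : 0 < x -> `|ln (x ^+ k)| = `|ln x| *+ k.
Proof. by move=> x0; rewrite lnXn // normrMn. Qed.

Lemma norm_ln_inner_accuracy n c1 (C : 'M[R]_n) (eps gamma : R) :
  (0 < n)%N -> 0 < c1 -> 0 < `|C| -> 0 < eps -> 0 < gamma ->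
  `|ln (inner_accuracy c1 C eps gamma)| <=
    `|ln c1| + (`|ln eps| *+ 2 + `|ln gamma| + (`|ln n%:R| + `|ln `|C| | *+ 2)).
Proof.
move=> n0 c10 C0 e0 g0; have nR0 : 0 < n%:R :> R by rewrite ltr0n.
have C2 := exprn_gt0 2 C0; have e2 := exprn_gt0 2 e0.
rewrite -!norm_lnXn //.
apply: (le_trans (norm_lnM c10 _)); first by rewrite divr_gt0 ?mulr_gt0.
rewrite lerD2l; apply: (le_trans (norm_ln_div _ _)); rewrite ?mulr_gt0 //.
by rewrite lerD // norm_lnM.
Qed.

Lemma norm_ln_sample_ratio n (C : 'M[R]_n) (beta gamma eps : R) :
  (0 < n)%N -> 0 < `|C| -> 0 < eps -> 0 < gamma -> 0 < beta ->
  `|ln (n%:R * `|C| ^+ 2 / (beta * gamma * eps))| <=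
    `|ln n%:R| + `|ln `|C| | *+ 2 + (`|ln beta| + `|ln gamma| + `|ln eps|).
Proof.
move=> n0 C0 e0 g0 b0; have nR0 : 0 < n%:R :> R by rewrite ltr0n.
have C2 := exprn_gt0 2 C0; have bg := mulr_gt0 b0 g0.
rewrite -!norm_lnXn //.
apply: (le_trans (norm_ln_div _ _)); rewrite ?mulr_gt0 //.
apply: lerD; first exact: norm_lnM.
by apply: (le_trans (norm_lnM bg e0)); rewrite lerD2r norm_lnM.
Qed.

Lemma norm_ln_reg_param n (eps : R) : (1 < n)%N -> 0 < eps ->
  `|ln (reg_param n eps)| <= `|ln eps| + `|ln 4| + `|ln n%:R| + 1.
Proof.
move=> n1 e0; have l0 := ln_nat_ge n1.
have lp : 0 < ln n%:R :> R by lra.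
rewrite reg_paramE (le_trans (norm_ln_div _ _)) // ?mulr_gt0 //.
have := @norm_lnM 4 (ln n%:R) (ltr0Sn _ _) lp.
(* [ln (ln n)] can be negative, but [ln n >= 1 / 2] gives [ln (ln n) >= 1 - 1 / ln n >= -1]. *)
suff : `|ln (ln n%:R)| <= `|ln n%:R| + 1 :> R by lra.
rewrite (ger0_norm (ltW lp)) ler_norml.
have := ln_sublinear lp; have := ln_ge_1subV lp.
have : (ln n%:R)^-1 <= 2 :> R by rewrite -[2]invrK lef_pV2 ?posrE //; lra.
lra.
Qed.

End ParamBounds.

(** * Operation count for the chosen parameters *)

Section Complexity.
Context {R : realType} (c1 c2 : R).
Hypotheses (c10 : 0 < c1) (c11 : c1 <= 1) (c20 : 0 < c2).
Variables (n : nat) (C : 'M[R]_n) (eps beta : R).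
Hypotheses (n1 : (1 < n)%N) (C0 : 0 < `|C|)
  (eps0 : 0 < eps) (epsC : eps <= `|C|) (beta0 : 0 < beta) (beta1 : beta < 1).

Local Notation gamma := (reg_param n eps).
Local Notation eps' := (inner_accuracy c1 C eps gamma).
Local Notation m := (sample_size c2 C beta gamma eps).
Local Notation ratio := (n%:R * `|C| ^+ 2 / (beta * gamma * eps)).
Local Notation lf := (log_factor [:: n%:R; `|C|; beta; eps]).

Let n0 : 0 < n%:R :> R.
Proof. by rewrite ltr0n ltnW. Qed.

Let gamma0 : 0 < gamma.
Proof. exact: reg_param_gt0. Qed.

(** Brings [eps'] into the range covered by the running-time guarantee. *)
Lemma inner_accuracy_le_norm : eps' <= `|C|.
Proof.
have g1 := reg_param_le n1 eps0; have g0 := gamma0.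
have n1R : 1 <= n%:R :> R by rewrite ler1n ltnW.
rewrite /inner_accuracy; move: (reg_param n eps) g1 g0 => g g1 g0.
rewrite mulrA ler_pdivrMr ?mulr_gt0 ?exprn_gt0 //.
apply: (@le_trans _ _ (1 * (`|C| ^+ 2 * `|C|))).
  have e0 := ltW eps0; have C0' := ltW C0; have g0' := ltW g0.
  apply: ler_pM; rewrite ?mulr_ge0 ?exprn_ge0 ?(ltW c10) //.
  apply: ler_pM; rewrite ?exprn_ge0 ?lerXn2r ?nnegrE //.
  by have := epsC; lra.
have -> : `|C| * (n%:R * `|C| ^+ 2) = n%:R * (`|C| ^+ 2 * `|C|) by ring.
by rewrite ler_wpM2r // mulr_ge0.
Qed.

(** Allows the [+ 1] from the ceiling in [m] to be absorbed into a multiple of [ratio]. *)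
Let ratio_ge1 : 1 <= ratio.
Proof.
have n1R : 1 <= n%:R :> R by rewrite ler1n ltnW.
have g1 := reg_param_le n1 eps0; have g0 := gamma0.
move: (reg_param n eps) g1 g0 => g g1 g0.
rewrite ler_pdivlMr ?mulr_gt0 // mul1r.
apply: (@le_trans _ _ (1 * `|C| * `|C|)).
  have e0 := ltW eps0; have g0' := ltW g0; have b0 := ltW beta0.
  apply: ler_pM; rewrite ?mulr_ge0 //; apply: ler_pM; rewrite ?(ltW beta1) //.
  by have := epsC; lra.
by rewrite -mulrA -expr2 ler_pM2r ?exprn_gt0.
Qed.

Lemma sample_size_gt0 : (0 < m)%N.
Proof.
rewrite -(@ltr0n R) (lt_le_trans _ (sample_size_ge _ _ _ _ _)) // mulr_gt0 //.
exact: lt_le_trans ratio_ge1.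
Qed.

Let m_le : m%:R <= (c2 + 1) * ratio.
Proof.
have r1 := ratio_ge1; have r0 : 0 <= c2 * ratio by exact: mulr_ge0 (ltW c20) (le_trans ler01 r1).
by rewrite (le_trans (sample_size_le r0)) // mulrDl mul1r lerD2l.
Qed.

Let lfE : lf = 1 + (`|ln n%:R| + (`|ln `|C| | + (`|ln beta| + `|ln eps|))).
Proof. by rewrite /log_factor !big_cons big_nil addr0. Qed.

(** Products and powers turn into sums of logarithms. [ln gamma] enters three times, by itself,
    through [m] and through [eps'], whence [3 * |ln 4|]. *)
Lemma log_factor_le :
  log_factor [:: n%:R; m%:R; `|C|; gamma; eps'] <=
    (15 + 3 * `|ln 4| + `|ln (c2 + 1)| + `|ln c1|) * lf.
Proof.
have lf1 : 1 <= lf by rewrite lfE lerDl !addr_ge0.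
have g := norm_ln_reg_param n1 eps0.
have c21 : 0 < c2 + 1 by have := c20; lra.
have e := norm_ln_inner_accuracy (ltnW n1) c10 C0 eps0 gamma0.
have m1 : 1 <= m%:R :> R by rewrite ler1n sample_size_gt0.
have hm : `|ln m%:R| <= `|ln (c2 + 1)| +
   (`|ln n%:R| + `|ln `|C| | *+ 2 + (`|ln beta| + `|ln gamma| + `|ln eps|)).
  rewrite ger0_norm ?ln_ge0 //; have r0 := lt_le_trans ltr01 ratio_ge1.
  apply: (@le_trans _ _ (ln ((c2 + 1) * ratio))).
    by rewrite ler_ln // posrE; [exact: lt_le_trans m1 | exact: mulr_gt0].
  apply: (le_trans (ler_norm _)); apply: (le_trans (norm_lnM c21 r0)).
  rewrite lerD2l; apply: norm_ln_sample_ratio; rewrite ?gamma0 //.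
  exact: ltnW.
have an := normr_ge0 (ln (n%:R : R)); have ac := normr_ge0 (ln `|C|).
have ab := normr_ge0 (ln beta); have ae := normr_ge0 (ln eps).
have t (x : R) : 0 <= x -> x <= x * lf by move=> x0; rewrite ler_peMr.
have t4 := t _ (normr_ge0 (ln 4)); have tc2 := t _ (normr_ge0 (ln (c2 + 1))).
have tc1 := t _ (normr_ge0 (ln c1)).
rewrite {1}/log_factor !big_cons big_nil addr0 !mulrDl.
rewrite !mulr2n in e hm.
have E := lfE; lra.
Qed.

(** Here [sqrt (gamma eps') = sqrt c1 eps gamma / (sqrt n |C|)]. With [m <= (c2 + 1) ratio] the
    count is of order [n^4 |C|^4 / (beta eps^2 gamma^2)], and [gamma = eps / (4 ln n)] contributes
    [16 (ln n)^2 / eps^2]; the logarithms go into [lf^2]. *)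
Lemma iteration_bound :
  m%:R * n%:R ^+ 2 * Num.sqrt n%:R * `|C| / Num.sqrt (gamma * eps') <=
    16 * (c2 + 1) / Num.sqrt c1 * (n%:R ^+ 4 * `|C| ^+ 4 / (beta * eps ^+ 4))
      * lf ^+ 2.
Proof.
have l0 := ln_nat_ge (R := R) n1; have lp : 0 < ln n%:R :> R by lra.
pose a := Num.sqrt c1; pose b : R := Num.sqrt n%:R.
have a0 : 0 < a by rewrite sqrtr_gt0.
have b0 : 0 < b by rewrite sqrtr_gt0.
have ea : c1 = a ^+ 2 by rewrite sqr_sqrtr ?ltW.
have eb : n%:R = b ^+ 2 by rewrite sqr_sqrtr ?ltW.
have g0 := gamma0; rewrite -/a -/b.
have -> : Num.sqrt (gamma * eps') = a * (eps * gamma / (b * `|C|)).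
  have -> : gamma * eps' = (a * (eps * gamma / (b * `|C|))) ^+ 2.
    rewrite /inner_accuracy ea eb; move: (reg_param n eps) => g.
    by field; rewrite !gt_eqF.
  rewrite sqrtr_sqr ger0_norm // ltW //.
  by rewrite mulr_gt0 // divr_gt0 // mulr_gt0.
have -> : m%:R * n%:R ^+ 2 * b * `|C| / (a * (eps * gamma / (b * `|C|))) =
    m%:R * (n%:R ^+ 3 * `|C| ^+ 2 / (a * eps * gamma)).
  rewrite -[n%:R ^+ 3]mulr1 eb; move: (m%:R : R) (reg_param n eps) g0 => M g g0.
  by field; rewrite !gt_eqF.
apply: (@le_trans _ _ ((c2 + 1) * ratio *
   (n%:R ^+ 3 * `|C| ^+ 2 / (a * eps * gamma)))).
  have aeg : 0 < a * eps * gamma by rewrite mulr_gt0 // mulr_gt0.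
  by rewrite ler_wpM2r // divr_ge0 ?(ltW aeg) // mulr_ge0 // exprn_ge0 ?(ltW C0).
have -> : (c2 + 1) * ratio *
    (n%:R ^+ 3 * `|C| ^+ 2 / (a * eps * gamma)) =
  16 * (c2 + 1) / a * (n%:R ^+ 4 * `|C| ^+ 4 / (beta * eps ^+ 4))
      * ln n%:R ^+ 2.
  by rewrite reg_paramE; field; rewrite !gt_eqF.
have c21 : 0 < c2 + 1 by have := c20; lra.
have ll : ln n%:R <= lf.
  by rewrite lfE (le_trans (ler_norm _)) // addrCA lerDl !addr_ge0.
have K0 : 0 <= 16 * (c2 + 1) / a * (n%:R ^+ 4 * `|C| ^+ 4 / (beta * eps ^+ 4)).
  apply: mulr_ge0; first by rewrite divr_ge0 ?(ltW a0) // mulr_ge0 // ltW.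
  by rewrite divr_ge0 ?mulr_ge0 ?exprn_ge0 ?(ltW beta0) ?(ltW eps0).
apply: ler_wpM2l => //.
by rewrite lerXn2r ?nnegrE ?(le_trans _ ll) ?(ltW lp).
Qed.

End Complexity.

Lemma accelerated_IBP_complexity (R : realType) (c1 c2 : R) :
  0 < c1 -> c1 <= 1 -> 0 < c2 ->
  forall accelerated_IBP : nat -> nat -> seq instr,
  accelerated_IBP_guarantee (R := R) accelerated_IBP ->
  exists (K : R) (k : nat),
  forall (n : nat) (C : 'M[R]_n) (eps beta : R),
  (1 < n)%N -> cost_matrix C -> 0 < `|C| ->
  0 < eps <= `|C| -> 0 < beta < 1 ->
  let gamma := reg_param n eps in
  let eps' := inner_accuracy c1 C eps gamma in
  let m := sample_size c2 C beta gamma eps in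
  forall q : 'I_m -> 'rV[R]_n, (forall i, simplex (q i)) ->
  exists (N : nat) (p : 'rV[R]_n),
  [/\ computes_in (accelerated_IBP n m) C q gamma eps' N p,
      is_approx_argmin eps' simplex (empirical_Wreg gamma C q) p
    & N%:R <= K * (n%:R ^+ 4 * `|C| ^+ 4 / (beta * eps ^+ 4))
                * log_factor [:: n%:R; `|C|; beta; eps] ^+ k].
Proof.
move=> c10 c11 c20 algo [K [k algoP]].
pose a := 15 + 3 * `|ln 4| + `|ln (c2 + 1)| + `|ln c1|.
(* The sign of [K] is unknown, hence [|K|]. The exponent adds 2 from [iteration_bound] to the [k] of
   the guarantee. *)
exists (`|K| * (16 * (c2 + 1) / Num.sqrt c1) * a ^+ k), (2 + k)%N.
move=> n C eps beta n1 Ccost C0 /andP[e0 eC] /andP[b0 b1] gamma eps' m q sq.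
have g0 : 0 < gamma by exact: reg_param_gt0.
have n0 : (0 < n)%N by exact: ltnW.
have gC : 0 < gamma <= `|C|.
  by rewrite g0 (le_trans (reg_param_le n1 e0)) //; lra.
have e'C : 0 < eps' <= `|C|.
  by rewrite inner_accuracy_gt0 // inner_accuracy_le_norm.
have m0 : (0 < m)%N by exact: sample_size_gt0.
have [N [p [comp app le]]] := algoP n m C q gamma eps' n1 m0 Ccost C0 sq gC e'C.
exists N, p; split=> //; apply: (le_trans le).
set lf := log_factor [:: n%:R; `|C|; _; _].
set Y := n%:R ^+ 4 * `|C| ^+ 4 / _.
set Z := m%:R * _ * _ * _ / _; set lf' := log_factor _.
have Z0 : 0 <= Z by rewrite divr_ge0 ?mulr_ge0 ?sqrtr_ge0.
have lf'0 : 0 <= lf' by rewrite addr_ge0 // sumr_ge0.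
apply: (@le_trans _ _ (`|K| * Z * lf' ^+ k)).
  by rewrite ler_wpM2r ?exprn_ge0 // ler_wpM2r // ler_norm.
apply: (@le_trans _ _ (`|K| * (16 * (c2 + 1) / Num.sqrt c1 * Y * lf ^+ 2)
    * (a * lf) ^+ k)); last first.
  by rewrite exprMn exprD le_eqVlt; apply/orP; left; apply/eqP; ring.
apply: ler_pM; rewrite ?exprn_ge0 ?mulr_ge0 //.
- by rewrite ler_wpM2l // iteration_bound.
- by rewrite lerXn2r ?nnegrE ?(le_trans lf'0) // log_factor_le.
Qed.

(** * Excess risk *)

Section Generalization.
Context {R : realType}.

Lemma W_sub_Wreg_sum n (C : 'M[R]_n) (T : finType) (mu : T -> R)
    (z : T -> 'rV[R]_n) gamma p :
  cost_matrix C -> (forall t, 0 <= mu t) -> \sum_t mu t = 1 ->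
  simplex p -> (forall t, simplex (z t)) -> 0 <= gamma ->
  \sum_t mu t * W C p (z t) <=
    pop_loss mu (fun p t => Wreg gamma C p (z t)) p + gamma * (2 * ln n%:R).
Proof.
move=> C0 mu0 mu1 sp sz g0.
set c := gamma * _; have -> : c = \sum_t mu t * c by rewrite -mulr_suml mu1 mul1r.
rewrite /pop_loss -big_split; apply: ler_sum => t _ /=.
by rewrite -mulrDr ler_wpM2l // W_leWreg.
Qed.

Lemma W_sum_lipschitz n (C : 'M[R]_n) (T : finType) (mu : T -> R)
    (z : T -> 'rV[R]_n) p p' :
  cost_matrix C -> (forall t, 0 <= mu t) -> \sum_t mu t = 1 ->
  simplex p -> simplex p' -> (forall t, simplex (z t)) ->
  \sum_t mu t * W C p (z t) <= \sum_t mu t * W C p' (z t) +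
    Num.sqrt n%:R * `|C| * l2norm (p - p').
Proof.
move=> C0 mu0 mu1 sp sp' sz.
set c := _ * l2norm _; have -> : c = \sum_t mu t * c by rewrite -mulr_suml mu1 mul1r.
rewrite -big_split; apply: ler_sum => t _ /=.
rewrite -mulrDr ler_wpM2l // -lerBlDl; exact: W_lipschitz.
Qed.

Lemma l2norm_near_argmin n (C : 'M[R]_n) gamma m (q : 'I_m -> 'rV[R]_n) p p' e :
  cost_matrix C -> (0 < m)%N -> 0 <= gamma -> (forall i, simplex (q i)) ->
  is_argmin simplex (empirical_Wreg gamma C q) p -> simplex p' ->
  empirical_Wreg gamma C q p' - empirical_Wreg gamma C q p <= e ->
  gamma / 8 * l2norm (p' - p) ^+ 2 <= e.
Proof.
move=> C0 m0 g0 sq [sp pmin] sp' le.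
(* The data become the identity sample over the finite space ['I_m], so that [near_minimizer_dist]
   applies with [delta = 0]. *)
pose loss p i := Wreg gamma C p (q i).
have empE x : emp_loss loss [ffun i => i] x = empirical_Wreg gamma C q x.
  by congr (_ * _); apply: eq_bigr => i _; rewrite ffunE.
have : 2 * (gamma / 16) * l2norm (p - p') ^+ 2 <= e + 2 * 0.
  apply: (@near_minimizer_dist _ _ m n simplex loss _ _ _ _ m0 [ffun i => i]) => //.
  - exact: simplex_midpoint.
  - by move=> x y i sx sy; exact: Wreg_midpoint.
  - by move=> x sx; rewrite !empE addr0; exact: pmin.
  - by rewrite !empE addrC -lerBlDr.
by rewrite l2normB; lra.
Qed.

(** Error budget: [eps / 2] for the regularization; [eps / 8] each for the inexactness of [phat],
    the stability term with [dl], and Markov's inequality; at most [eps / 32] for replacing [phatg]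
    by [ph], and [eps / 16] for rounding. *)
Lemma excess_risk_bound (L : R) n (C : 'M[R]_n) (rho eps beta c1 c2 : R) :
  0 < L -> c1 = 8^-1 ^+ 3 -> c2 = (16 * L) ^+ 2 ->
  (1 < n)%N -> cost_matrix C -> 0 < `|C| ->
  0 < eps -> 0 < beta < 1 ->
  let gamma := reg_param n eps in
  let eps' := inner_accuracy c1 C eps gamma in
  let m := sample_size c2 C beta gamma eps in
  lipschitz_convention L rho gamma C ->
  forall (d : measure_display) (Omega : measurableType d)
         (Pr : probability Omega R)
         (P : probability (borel_rV R n) R)
         (q : 'I_m -> {RV Pr >-> borel_rV R n}),
  P (inner_simplex rho) = 1%E -> iid_sample P q ->
  forall (phat phat_gamma : Omega -> 'rV[R]_n) (pstar : 'rV[R]_n),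
  {ae Pr, forall w,
    let F := empirical_Wreg gamma C (fun i => q i w) in
    [/\ is_argmin simplex F (phat_gamma w),
        inner_simplex rho (phat_gamma w),
        simplex (phat w)
      & F (phat w) - F (phat_gamma w) <= eps']} ->
  is_argmin simplex (population_W C P) pstar ->
  with_probability_ge Pr (1 - beta)
    [set w | population_W C P (phat w) - population_W C P pstar <= eps].
Proof.
move=> L0 c1E c2E n1 C0 Cp e0 /andP[b0 b1] gamma eps' m lipc d Omega Pr P q
  P1 iid phat phatg pstar good [sst _].
have c20 : 0 < c2 by rewrite c2E exprn_gt0 // mulr_gt0.
have g0 : 0 < gamma by exact: reg_param_gt0.
have l0 : 0 < ln n%:R :> R by rewrite (lt_le_trans _ (ln_nat_ge n1)).
have gln : gamma * (2 * ln n%:R) = eps / 2.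
  by rewrite /gamma reg_paramE; field; rewrite gt_eqF.
have n0 : 0 < n%:R :> R by rewrite ltr0n ltnW.
have mge : (16 * L) ^+ 2 * (n%:R * `|C| ^+ 2 / (beta * gamma * eps)) <= m%:R.
  by rewrite -c2E; exact: sample_size_ge.
have m0 : (0 < m)%N.
  rewrite -(@ltr0n R) (lt_le_trans _ mge) // -c2E mulr_gt0 //.
  by rewrite divr_gt0 // mulr_gt0 // ?exprn_gt0 // mulr_gt0.
have mR0 : 0 < m%:R :> R by rewrite ltr0n.
have [CT _] := C0.
have e'E : eps' = c1 * (eps ^+ 2 * gamma / (n%:R * `|C| ^+ 2)) by [].
clearbody m eps' gamma.
pose K := Num.sqrt n%:R * `|C|; pose M := L * Num.sqrt n%:R * `|C|.
have K0 : 0 < K by rewrite mulr_gt0 // sqrtr_gt0.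
have K2 : K ^+ 2 = n%:R * `|C| ^+ 2 by rewrite exprMn sqr_sqrtr // ltW.
have ME : M = L * K by rewrite /M /K mulrA.
have M0 : 0 < M by rewrite ME mulr_gt0.
have M2 : M ^+ 2 = L ^+ 2 * (n%:R * `|C| ^+ 2) by rewrite ME exprMn K2.
pose kappa := gamma / 16; have k0 : 0 < kappa by rewrite divr_gt0.
have be0 : 0 < beta * eps by exact: mulr_gt0.
have bele : beta * eps <= eps by rewrite ger_pMl // ltW.
(* [M tau] enters the stability bound, [K tau] the cost of passing from [phatg w] to [ph s]. *)
pose tau := beta * eps / (32 * (M + K)).
have MK0 : 0 < M + K by exact: addr_gt0.
have tau0 : 0 < tau by rewrite divr_gt0 ?mulr_gt0.
have Mtau : (M + K) * tau = beta * eps / 32.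
  by rewrite /tau; field; rewrite gt_eqF.
have kt0 : 0 < kappa * tau ^+ 2 by rewrite mulr_gt0 ?exprn_gt0.
(* The second bound serves both the stability condition [3 dl <= 2 kappa tau^2] and, together with
   [M delta <= kappa tau^2 / 2], the distance from [phatg w] to [ph s]. *)
pose dl := Num.min (beta * eps / 32) (kappa * tau ^+ 2 / 2).
have dl0 : 0 < dl by rewrite lt_min !divr_gt0.
have dl1 : dl <= beta * eps / 32 by rewrite ge_min lexx.
have dl2 : dl <= kappa * tau ^+ 2 / 2 by rewrite ge_min lexx orbT.
pose d3 := Num.min (kappa * tau ^+ 2 / 2) (eps / 16).
have d30 : 0 < d3 by rewrite lt_min !divr_gt0.
have d31 : d3 <= kappa * tau ^+ 2 / 2 by rewrite ge_min lexx.
have d32 : d3 <= eps / 16 by rewrite ge_min lexx orbT.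
(* Rounding costs [|C| delta] in the population cost at [phat w] and at [pstar], [|C| delta] in the
   empirical cost at [pstar], and [M delta] in the empirical regularized loss. *)
pose delta := d3 / (3 * `|C| + M).
have CM0 : 0 < 3 * `|C| + M by rewrite addr_gt0 // mulr_gt0.
have delta0 : 0 < delta by rewrite divr_gt0.
have deltaE : (3 * `|C| + M) * delta = d3 by rewrite mulrC divfK ?gt_eqF.
have [T [cell [mcell tcell cellU diam]]] :=
  @inner_simplex_partition R n rho delta delta0.
have [z0 iz0] : exists z0 : 'rV[R]_n, inner_simplex rho z0.
  apply: contrapT => h; have : P (inner_simplex rho) = 0%E.
    rewrite (_ : inner_simplex rho = set0) ?measure0 //.
    by apply/seteqP; split=> // x ix; apply: h; exists x.
  by rewrite P1 => /eqP; rewrite onee_eq0.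
have cellI t x : cell t x -> inner_simplex rho x.
  by move=> tx; rewrite -cellU; exists t.
(* Empty cells receive the default [z0], so that every [z t] is in the inner simplex. *)
have /choice[z zP] : forall t, exists x : 'rV[R]_n,
    inner_simplex rho x /\ (cell t !=set0 -> cell t x).
  move=> t; have [->|/set0P[x tx]] := eqVneq (cell t) set0.
    by exists z0; split=> // -[].
  by exists x; split=> //; exact: cellI tx.
have zin t := (zP t).1; have zs t : simplex (z t) by case: (zin t).
have zd t x : cell t x -> \sum_j `|x 0 j - z t 0 j| <= delta.
  by move=> tx; apply: diam (tx) _; apply: (zP t).2; exists x.
pose mu := cell_mass P cell.
have mu0 t : 0 <= mu t by rewrite fine_ge0.
have mu1 : \sum_t mu t = 1.
  apply: EFin_inj; rewrite -sumEFin -P1 -cellU.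
  have [_] := measure_bigcup_fintype P predT mcell tcell.
  rewrite (_ : [set i | predT i] = [set: T]); last by apply/seteqP.
  by move=> ->; apply: eq_bigr => t _; rewrite fineK // fin_num_measure.
pose WT p := \sum_t mu t * W C p (z t).
have popW p : simplex p -> `|population_W C P p - WT p| <= `|C| * delta.
  by move=> sp; apply: (population_W_approx C0 sp (ltW delta0) P1 mcell tcell cellU zin).
pose loss p t := Wreg gamma C p (z t).
have lip t : lipschitz_l2 (inner_simplex rho) M (loss ^~ t).
  by have [_] := lipc (z t) (zin t).
have mid p p' t : inner_simplex rho p -> inner_simplex rho p' ->
    loss (2^-1 *: (p + p')) t <=
      (loss p t + loss p' t) / 2 - kappa * l2norm (p - p') ^+ 2.
  by move=> [sp _] [sp' _]; apply: Wreg_midpoint => //; exact: ltW.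
(* The auxiliary estimator [ph] depends on the cells alone, hence is a function on a finite type.
   The lower bound [- eps / 2] follows from [W >= 0] and [W <= Wreg + eps / 2]. *)
have /choice[ph phP] : forall s : {ffun 'I_m -> T}, exists x,
    inner_simplex rho x /\ forall p, inner_simplex rho p ->
      emp_loss loss s x <= emp_loss loss s p + dl.
  move=> s; apply: (@near_minimizer_exists _ _ _ _ (- (eps / 2))) => //.
    by exists z0.
  move=> p [sp _]; rewrite /emp_loss -[leLHS](@avg_const _ m) //.
  rewrite ler_pM2l ?invr_gt0 // ler_sum // => i _.
  have := W_leWreg C0 sp (zs (s i)) (ltW g0); rewrite gln.
  by have := W_ge0 C0 p (z (s i)); rewrite /loss; lra.
have phin s := (phP s).1; have phmin s := (phP s).2.
have phs s : simplex (ph s) by case: (phin s).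
(* The comparison passes through [phatg w]: it lies in the inner simplex, so [ph s] competes with
   it, and it minimizes over the whole simplex, so it competes with [pstar]. *)
have key (w : Omega) s :
    (let F := empirical_Wreg gamma C (fun i => q i w) in
    [/\ is_argmin simplex F (phatg w),
        inner_simplex rho (phatg w),
        simplex (phat w)
      & F (phat w) - F (phatg w) <= eps']) ->
    sample_cell q cell s w ->
    [/\ emp_loss loss s (ph s) <= m%:R^-1 * (\sum_i W C pstar (z (s i)))
          + ((`|C| + M) * delta + dl),
        l2norm (phat w - phatg w) <= eps / 8 / K
      & l2norm (phatg w - ph s) <= tau].
  move=> /= [[sg gmin] ig sph le] sw.
  have qin i : inner_simplex rho (q i w) by exact: cellI (sw i I).
  have qs i : simplex (q i w) by case: (qin i).
  have qd i : \sum_j `|(q i w : 'rV[R]_n) 0 j - z (s i) 0 j| <= delta.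
    exact: zd (sw i I).
  have dF p : inner_simplex rho p ->
      `|empirical_Wreg gamma C (fun i => q i w) p - emp_loss loss s p|
        <= M * delta.
    move=> ip; rewrite /empirical_Wreg /emp_loss -mulrBr -sumrB normrM.
    rewrite ger0_norm ?invr_ge0 // -[leRHS](@avg_const _ m) //.
    rewrite ler_pM2l ?invr_gt0 // (le_trans (ler_norm_sum _ _ _)) //.
    apply: ler_sum => i _; rewrite /loss (Wreg_sym gamma p _ CT).
    rewrite (Wreg_sym gamma p (z _) CT).
    have [_ lipp] := lipc p ip; apply: le_trans (lipp _ _ (qin i) (zin _)) _.
    rewrite ler_pM2l //; apply: le_trans (l2norm_le_sum_norm _) _.
    by under eq_bigr do rewrite !mxE; exact: qd.
  have Mdelta : M * delta <= d3.
    by rewrite -deltaE ler_pM2r // lerDr mulr_ge0 // ltW.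
  have Fg := dF _ ig; have Fph := dF _ (phin s).
  rewrite !ler_norml in Fg Fph.
  split.
  - have := phmin s _ ig; have := gmin _ sst.
    have : empirical_Wreg gamma C (fun i => q i w) pstar <=
        m%:R^-1 * (\sum_i W C pstar (z (s i))) + `|C| * delta.
      rewrite -[X in _ + X](@avg_const _ m) // -mulrDr.
      rewrite ler_pM2l ?invr_gt0 // -big_split; apply: ler_sum => i _ /=.
      apply: le_trans (Wreg_leW C0 sst (qs i) (ltW g0)) _.
      rewrite -lerBlDl; apply: le_trans (W_lipschitz_r C0 sst (qs i) (zs _)) _.
      by rewrite ler_wpM2l.
    lra.
  - have := l2norm_near_argmin C0 m0 (ltW g0) qs (conj sg gmin) sph le.
    (* Origin of [c1 = 8^-3]: one factor 8 from the modulus [gamma / 8], two from the squared target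
       distance [eps / (8 K)]. *)
    have -> : eps' = gamma / 8 * (eps / 8 / K) ^+ 2.
      by rewrite e'E c1E -K2; field; rewrite gt_eqF.
    rewrite ler_pM2l ?divr_gt0 // ler_pXn2r // nnegrE ?l2norm_ge0 //.
    by rewrite !divr_ge0 // ltW.
  - have h : 2 * kappa * l2norm (ph s - phatg w) ^+ 2 <= 2 * (M * delta) + 2 * dl.
      apply: (near_minimizer_dist (@inner_simplex_midpoint R n rho) mid m0
        (phin s) ig (phmin s)).
      by have := gmin _ (phs s); lra.
    rewrite l2normB -(@ler_pXn2r _ 2) ?nnegrE ?l2norm_ge0 ?(ltW tau0) //.
    by rewrite -(ler_pM2l k0); lra.
set B := M * (M / (kappa * m%:R) + tau).
have Bdl : B + dl <= beta * (eps / 8).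
  (* Origin of [c2 = (16 L)^2]: the left side is [16 L^2 n |C|^2 / (gamma m)], which this sample
     size makes at most [beta eps / 16]. *)
  have h : M * (M / (kappa * m%:R)) <= beta * eps / 16.
    rewrite mulrA -expr2 M2 ler_pdivrMr ?mulr_gt0 //.
    move: mge; rewrite mulrA ler_pdivrMr ?mulr_gt0 // /kappa; lra.
  by have := mulr_ge0 (ltW K0) (ltW tau0); rewrite /B; lra.
set v := WT pstar + ((`|C| + M) * delta + dl).
have empv : \sum_s prod_mass mu s * emp_loss loss s (ph s) <= v.
  have -> : v = \sum_(s : {ffun 'I_m -> T}) prod_mass mu s * (m%:R^-1 * (\sum_i W C pstar (z (s i)))
      + ((`|C| + M) * delta + dl)).
    under eq_bigr do rewrite mulrDr.
    rewrite big_split /= -mulr_suml (prod_mass_sum1 mu1) mul1r; congr (_ + _).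
    exact: esym (@pop_loss_sum _ _ _ m mu1 n (fun p t => W C p (z t)) m0 pstar).
  apply: ler_sum => s _; have [->|s0] := eqVneq (prod_mass mu s) 0.
    by rewrite !mul0r.
  have [w gw sw] := sample_cell_meets iid mcell good s0.
  by rewrite ler_wpM2l ?prod_mass_ge0 //; have [] := key w s gw sw.
have prob := erm_excess_prob mu0 mu1 (@inner_simplex_midpoint R n rho) lip mid
  (ltW M0) k0 tau0 m0 (_ : 3 * dl <= 2 * kappa * tau ^+ 2) phin phmin
  (_ : 0 < eps / 8) Bdl empv.
have [A [mA AE PA]] := with_probability_ge_cells iid mcell tcell good
  (prob ltac:(lra) ltac:(lra)).
exists A; split=> // w /AE[gw [s Es sw]].
have [_ D2 D1] := key w s gw sw; have /= [_ _ sph _] := gw; have [[sg _] _ _ _] := gw.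
have e1 := popW _ sph; have e2 := popW _ sst; rewrite !ler_norml in e1 e2.
have w1 : WT (phat w) <= WT (phatg w) + K * l2norm (phat w - phatg w).
  exact: W_sum_lipschitz.
have w2 : WT (phatg w) <= WT (ph s) + K * l2norm (phatg w - ph s).
  exact: W_sum_lipschitz.
have w3 : WT (ph s) <= pop_loss mu loss (ph s) + eps / 2.
  by rewrite -gln; apply: W_sub_Wreg_sum => //; exact: ltW.
have w4 : pop_loss mu loss (ph s) <= v + B + eps / 8 by exact: Es.
have KD2 : K * l2norm (phat w - phatg w) <= eps / 8.
  by rewrite mulrC -ler_pdivlMr.
have KD1 := ler_wpM2l (ltW K0) D1.
have Mt0 := mulr_ge0 (ltW M0) (ltW tau0).
rewrite mulrDl in Mtau; rewrite mulrDl -mulrA in deltaE.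
have vE : v = WT pstar + (`|C| * delta + M * delta + dl) by rewrite /v mulrDl.
clear - e1 e2 w1 w2 w3 w4 KD2 KD1 Mt0 Mtau deltaE vE Bdl dl0 bele d32 e0.
clearbody v B WT K M d3 delta dl; lra.
Qed.

End Generalization.

Theorem theorem2p4p3 (R : realType) (L : R) (hL : 0 < L) :
  exists c1 c2 : R,
  [/\ 0 < c1, 0 < c2,
      forall (n : nat) (C : 'M[R]_n) (rho eps beta : R),
      (1 < n)%N -> cost_matrix C -> 0 < `|C| ->
      0 < rho -> 0 < eps -> 0 < beta < 1 ->
      let gamma := reg_param n eps in
      let eps' := inner_accuracy c1 C eps gamma in
      let m := sample_size c2 C beta gamma eps in
      lipschitz_convention L rho gamma C ->
      forall (d : measure_display) (Omega : measurableType d)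
             (Pr : probability Omega R)
             (P : probability (borel_rV R n) R)
             (q : 'I_m -> {RV Pr >-> borel_rV R n}),
      P (inner_simplex rho) = 1%E -> iid_sample P q ->
      forall (phat phat_gamma : Omega -> 'rV[R]_n) (pstar : 'rV[R]_n),
      {ae Pr, forall w,
        let F := empirical_Wreg gamma C (fun i => q i w) in
        [/\ is_argmin simplex F (phat_gamma w),
            inner_simplex rho (phat_gamma w),
            simplex (phat w)
          & F (phat w) - F (phat_gamma w) <= eps']} ->
      is_argmin simplex (population_W C P) pstar ->
      with_probability_ge Pr (1 - beta)
        [set w | population_W C P (phat w) - population_W C P pstar <= eps]
    & forall accelerated_IBP : nat -> nat -> seq instr,
      accelerated_IBP_guarantee (R := R) accelerated_IBP ->
      exists (K : R) (k : nat),
      forall (n : nat) (C : 'M[R]_n) (eps beta : R),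
      (1 < n)%N -> cost_matrix C -> 0 < `|C| ->
      0 < eps <= `|C| -> 0 < beta < 1 ->
      let gamma := reg_param n eps in
      let eps' := inner_accuracy c1 C eps gamma in
      let m := sample_size c2 C beta gamma eps in
      forall q : 'I_m -> 'rV[R]_n, (forall i, simplex (q i)) ->
      exists (N : nat) (p : 'rV[R]_n),
      [/\ computes_in (accelerated_IBP n m) C q gamma eps' N p,
          is_approx_argmin eps' simplex (empirical_Wreg gamma C q) p
        & N%:R <= K * (n%:R ^+ 4 * `|C| ^+ 4 / (beta * eps ^+ 4))
                    * log_factor [:: n%:R; `|C|; beta; eps] ^+ k]].
Proof.
(* [c1] is absolute and [c2] depends on [L] only; [c1 <= 1] is what the complexity bound asks
   for. *)
exists (8^-1 ^+ 3), ((16 * L) ^+ 2).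
have c10 : 0 < 8^-1 ^+ 3 :> R by rewrite exprn_gt0 // invr_gt0.
have c20 : 0 < (16 * L) ^+ 2 by rewrite exprn_gt0 // mulr_gt0.
split=> // [n C rho eps beta n1 C0 Cp _|].
  exact: excess_risk_bound.
apply: accelerated_IBP_complexity => //.
by rewrite exprn_ile1 // ?invr_ge0 // invf_le1 // ler1n.
Qed.
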